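(* There exists a triple $(\bar a,\bar b,\bar t)$ with $|\bar a-a_0|<sa+da$, $|\bar b-b_0|<sb$ and $|\bar t-t_0|<6(st+dt)$ such that the solution of the three body problem (gravitational constant $1$, the body at $x(t)$ having mass $200$ and the bodies at $y(t)$ and $z(t)$ each having mass $100$) given by $$x(t)=(0,0,F(t,\bar a,\bar b)),$$ $$y(t)=\left(R(t,\bar a,\bar b)\cos\Theta(t,\bar a,\bar b),\;R(t,\bar a,\bar b)\sin\Theta(t,\bar a,\bar b),\;-F(t,\bar a,\bar b)\right),$$ $$z(t)=\left(-R(t,\bar a,\bar b)\cos\Theta(t,\bar a,\bar b),\;-R(t,\bar a,\bar b)\sin\Theta(t,\bar a,\bar b),\;-F(t,\bar a,\bar b)\right)$$ is periodic with period $36\,\bar t$. Moreover, $\Theta(\bar t,\bar a,\bar b)=\frac{7\pi}{18}$.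
   Context: For real parameters $a,b$, let $f,r,\theta$ (with $r>0$) be the maximal solution of $$\ddot f=-\frac{400}{s^3}f,\qquad \ddot r=\frac{100a^2}{r^3}-\frac{25}{r^2}-\frac{200\,r}{s^3},\qquad r^2\dot\theta=10a,\qquad s=\sqrt{r^2+4f^2},$$ with $f(0)=0$, $\dot f(0)=b$, $r(0)=10$, $\dot r(0)=0$, $\theta(0)=0$. Write $F(t,a,b)=f(t)$, $R(t,a,b)=r(t)$, $\Theta(t,a,b)=\theta(t)$. Constants: $a_0=\frac{43170475352787}{10000000000000}$, $da=\frac{17}{50000000}$, $sa=\frac{1197}{100000000}$ ($da$ and $sa$ are single symbols, as are those below); $b_0=\frac{1490359743}{1000000000}$, $sb=\frac{1}{50000}$; $t_0=\frac{13366894627923}{5000000000000}$, $dt=\frac{1}{2500000}$, $st=\frac{11}{2000000}$. Three body problem: positions $q_1,q_2,q_3$ in $\mathbb{R}^3$ with masses $m_1,m_2,m_3$ satisfy $\ddot q_i=\sum_{j\ne i}m_j\frac{q_j-q_i}{|q_j-q_i|^3}$. *)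

(* Defs.v *)
From Stdlib Require Import Reals PeanoNat.
From Coquelicot Require Import Coquelicot.
Open Scope R_scope.

Definition in_interval (lo hi : Rbar) (t : R) : Prop :=
  Rbar_lt lo t /\ Rbar_lt t hi.

(* Differentiability of [f] and [r] is required separately because Coquelicot's
   [Derive_n] is total. *)
Record is_solution (a b : R) (lo hi : Rbar) (f r theta : R -> R) : Prop := {
  sol_zero_in : in_interval lo hi 0;
  sol_f_0 : f 0 = 0;
  sol_df_0 : Derive f 0 = b;
  sol_r_0 : r 0 = 10;
  sol_dr_0 : Derive r 0 = 0;
  sol_theta_0 : theta 0 = 0;
  sol_r_pos : forall t, in_interval lo hi t -> 0 < r t;
  sol_f_diff : forall t, in_interval lo hi t -> ex_derive f t;
  sol_r_diff : forall t, in_interval lo hi t -> ex_derive r t;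
  sol_theta_diff : forall t, in_interval lo hi t -> ex_derive theta t;
  sol_f_eq : forall t, in_interval lo hi t ->
    let s := sqrt (r t ^ 2 + 4 * f t ^ 2) in
    is_derive_n f 2 t (- (400 / s ^ 3) * f t);
  sol_r_eq : forall t, in_interval lo hi t ->
    let s := sqrt (r t ^ 2 + 4 * f t ^ 2) in
    is_derive_n r 2 t
      (100 * a ^ 2 / r t ^ 3 - 25 / r t ^ 2 - 200 * r t / s ^ 3);
  sol_theta_eq : forall t, in_interval lo hi t ->
    r t ^ 2 * Derive theta t = 10 * a
}.

(* "The" maximal solution is the one extending every other solution of the
   initial value problem; this determines the interval, and the functions on
   it. *)
Definition is_maximal_solution (a b : R) (lo hi : Rbar) (f r theta : R -> R)
    : Prop :=
  is_solution a b lo hi f r theta /\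
  forall (lo' hi' : Rbar) (f' r' theta' : R -> R),
    is_solution a b lo' hi' f' r' theta' ->
    Rbar_le lo lo' /\ Rbar_le hi' hi /\
    forall t, in_interval lo' hi' t ->
      f' t = f t /\ r' t = r t /\ theta' t = theta t.

(* Coquelicot's [norm] on a product is the square root of the sum of the squared
   norms, hence the Euclidean norm on this type. *)
Definition vec3 : Type := (R * R * R)%type.

Definition attraction (m : nat -> R) (p : nat -> vec3) (i j : nat) : vec3 :=
  scal (m j / norm (minus (p j) (p i)) ^ 3) (minus (p j) (p i)).

(* The bodies are indexed by 0, 1, 2; [sum_n _ 2] has three terms. *)
Definition three_body_solution (m : nat -> R) (q : nat -> R -> vec3) : Prop :=
  (forall t i j, (i < 3)%nat -> (j < 3)%nat -> i <> j -> q i t <> q j t) /\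
  exists v : nat -> R -> vec3, forall t i, (i < 3)%nat ->
    is_derive (q i) t (v i t) /\
    is_derive (v i) t
      (sum_n (fun j => if Nat.eqb j i then zero
                       else attraction m (fun k => q k t) i j) 2).

Definition periodic_motion (T : R) (q : nat -> R -> vec3) : Prop :=
  0 < T /\ forall t i, (i < 3)%nat -> q i (t + T) = q i t.

Definition masses (i : nat) : R := match i with O => 200 | _ => 100 end.

Definition motion (f r theta : R -> R) (i : nat) (t : R) : vec3 :=
  match i with
  | O => (0, 0, f t)
  | S O => (r t * cos (theta t), r t * sin (theta t), - f t)
  | _ => (- (r t * cos (theta t)), - (r t * sin (theta t)), - f t)
  end.

Definition a0 : R := 43170475352787 / 10000000000000.
Definition da : R := 17 / 50000000.
Definition sa : R := 1197 / 100000000.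
Definition b0 : R := 1490359743 / 1000000000.
Definition sb : R := 1 / 50000.
Definition t0 : R := 13366894627923 / 5000000000000.
Definition dt : R := 1 / 2500000.
Definition st : R := 11 / 2000000.

(* Main.v *)
(* After rescaling time by the quarter period and lengths by 10, the motion is sought on
   [0, 1] with f' = r' = 0 and theta = 7 pi / 18 at the end; reflecting it in both ends of the
   interval extends it to the whole line, since f is odd at 0 and f, r are stationary at 1.

   Write the motion as a polynomial model, plus its approximate variation with three shooting
   parameters, plus a remainder. The discrepancy h between the true accelerations along the
   motion and those of the model determines the remainder by integration and, as the
   variations are normalised to act as the identity on the terminal data, the parameters by
   one quadrature. Thus the boundary value problem is a fixed point equation for h in a space
   of continuous functions, which is a contraction for the weight exp (4 t). The Lipschitz
   constant and the defect of the model are bounded by exact integer arithmetic on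
   polynomials with error bounds, where inverses and square roots are verified from
   approximations given in advance. *)
Require Import Defs.
From Stdlib Require Import Reals.
From Coquelicot Require Import Coquelicot.
From Stdlib Require Import Lra Lia ZArith List Machin.
Open Scope R_scope.

(** * Polynomial enclosures *)

(** The two kinds of unknowns are controlled by different mechanisms. Remainders of the positions
    are double integrals of the discrepancy, so the weight [exp (4 t)] gains a factor 1/16 on them,
    enough against slopes bounded by 12. The parameters come from integrals up to time 1 and may be
    20 times the weighted norm, 320 times as large as that gain allows. They stay harmless because
    the variations nearly solve the linearised equations, so the discrepancy hardly depends on the
    parameters.

    Taking the discrepancy of the accelerations as unknown means that only continuity has to survive
    the limit; positions and velocities are recovered as primitives.

    The reflections give [f] a period of four cells. The angle grows by [7 * PI / 18] per cell, so
    36 cells, nine oscillations of [f], make seven full turns and close the orbit in space. The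
    motion being global, its maximality reduces to uniqueness on an arbitrary interval around 0. *)

Fixpoint peval (l : list Z) (x : R) : R :=
  match l with nil => 0 | a :: l' => IZR a + x * peval l' x end.

Fixpoint norm1 (l : list Z) : Z :=
  match l with nil => 0%Z | a :: l' => (Z.abs a + norm1 l')%Z end.

Fixpoint padd (l k : list Z) : list Z :=
  match l, k with
  | nil, _ => k
  | _, nil => l
  | a :: l', b :: k' => (a + b)%Z :: padd l' k'
  end.

Definition pscale (c : Z) (l : list Z) : list Z := map (Z.mul c) l.

Definition psub (l k : list Z) : list Z := padd l (pscale (-1) k).

Fixpoint pmul (l k : list Z) : list Z :=
  match l with
  | nil => nil
  | a :: l' => padd (pscale a k) (0%Z :: pmul l' k)
  end.

Fixpoint pderiv_from (n : Z) (l : list Z) : list Z :=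
  match l with nil => nil | a :: l' => (n * a)%Z :: pderiv_from (n + 1) l' end.

Definition pderiv (l : list Z) : list Z :=
  match l with nil => nil | _ :: l' => pderiv_from 1 l' end.

Lemma peval_padd l k x : peval (padd l k) x = peval l x + peval k x.
Proof.
revert k; induction l as [|a l IH]; intros [|b k]; simpl; try ring.
rewrite plus_IZR, IH; ring.
Qed.

Lemma peval_pscale c l x : peval (pscale c l) x = IZR c * peval l x.
Proof.
induction l as [|a l IH]; simpl; [ring|].
fold (pscale c l); rewrite mult_IZR, IH; ring.
Qed.

Lemma peval_psub l k x : peval (psub l k) x = peval l x - peval k x.
Proof. unfold psub; rewrite peval_padd, peval_pscale; ring. Qed.

Lemma peval_pmul l k x : peval (pmul l k) x = peval l x * peval k x.
Proof.
induction l as [|a l IH]; simpl; [ring|].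
rewrite peval_padd, peval_pscale; simpl; rewrite IH; ring.
Qed.

Lemma peval_norm1 l x : Rabs x <= 1 -> Rabs (peval l x) <= IZR (norm1 l).
Proof.
intros Hx; induction l as [|a l IH]; simpl.
  rewrite Rabs_R0; lra.
rewrite plus_IZR, abs_IZR.
eapply Rle_trans; [apply Rabs_triang|].
apply Rplus_le_compat_l; rewrite Rabs_mult.
assert (H := Rabs_pos (peval l x)); nra.
Qed.

Lemma peval_pderiv_cons a l x :
  peval (pderiv (a :: l)) x = peval l x + x * peval (pderiv l) x.
Proof.
(* Raising the starting index by one adds every coefficient once more; this is the term [peval l x]
   of the product rule for [a + x * l]. *)
assert (H : forall n k, peval (pderiv_from (n + 1) k) x
                      = peval k x + peval (pderiv_from n k) x).
  intros n k; revert n; induction k as [|b k IH]; intros n; simpl; [ring|].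
  rewrite IH, mult_IZR, plus_IZR, mult_IZR; ring.
destruct l as [|b l]; unfold pderiv; [simpl; ring|].
cbn [pderiv_from peval]; rewrite (H 1%Z l), mult_IZR; ring.
Qed.

Lemma is_derive_peval l (x : R) : is_derive (peval l) x (peval (pderiv l) x).
Proof.
induction l as [|a l IH].
  apply (is_derive_ext (fun _ => 0)); [reflexivity|simpl; auto_derive; auto].
rewrite peval_pderiv_cons.
apply (is_derive_ext (fun y => IZR a + y * peval l y)); [reflexivity|].
auto_derive; [exists (peval (pderiv l) x); exact IH|].
replace (Derive _ _) with (peval (pderiv l) x) by (symmetry; now apply is_derive_unique); ring.
Qed.

Definition coef_lower (l : list Z) : Z :=
  match l with nil => 0%Z | a :: l' => (a - norm1 l')%Z end.

Lemma peval_coef_lower l x : Rabs x <= 1 -> IZR (coef_lower l) <= peval l x.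
Proof.
intros Hx; destruct l as [|a l]; simpl; [lra|].
rewrite minus_IZR.
assert (H : Rabs (x * peval l x) <= IZR (norm1 l)).
  rewrite Rabs_mult; assert (H := peval_norm1 l x Hx).
  assert (H1 := Rabs_pos (peval l x)); nra.
apply Rabs_le_between in H; lra.
Qed.

(* A number [y] depending on [x] is enclosed by [|y S - coefs(x)| <= err], unless
   [valid] records that one of the side conditions met on the way failed. *)
Record model : Type := Model { coefs : list Z; err : Z; valid : bool }.

Definition encloses (S : Z) (x : R) (m : model) (y : R) : Prop :=
  valid m = true -> Rabs (y * IZR S - peval (coefs m) x) <= IZR (err m).

Section ModelArithmetic.

Variables (S : Z) (N : nat) (x : R).
Hypothesis S_pos : (0 < S)%Z.
Hypothesis x_unit : Rabs x <= 1.

Let IZR_S_pos : 0 < IZR S.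
Proof. now apply IZR_lt. Qed.

(** The norm of [l - d * low] pays at once for the rounding of the kept coefficients and for the
    powers dropped beyond [N]; the final 1 absorbs the floor division. *)
Definition round_to (d e : Z) (l : list Z) (v : bool) : model :=
  let low := map (fun a => (a / d)%Z) (firstn N l) in
  Model low ((e + norm1 (psub l (pscale d low))) / d + 1) v.

Definition madd (m n : model) : model :=
  Model (padd (coefs m) (coefs n)) (err m + err n) (valid m && valid n).

Definition mscale (p d : Z) (m : model) : model :=
  round_to d (Z.abs p * err m) (pscale p (coefs m)) (valid m && (0 <? d)%Z).

Definition mopp (m : model) : model :=
  Model (pscale (-1) (coefs m)) (err m) (valid m).

Definition mmul (m n : model) : model :=
  round_to S
    (norm1 (coefs m) * err n + norm1 (coefs n) * err m + err m * err n)
    (pmul (coefs m) (coefs n)) (valid m && valid n).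

(** The guess [u] for [S / y] is checked a posteriori: [d] bounds [|S^2 - y S u|]. The test
    [2 d <= S^2] forces [|y u| >= S / 2], which shows [y <> 0] and replaces the unknown [1 / |y|] by
    [2 |u| / S] in the error. *)
Definition minv (m : model) (u : list Z) : model :=
  let d := (norm1 (psub (S * S :: nil)%Z (pmul (coefs m) u))
            + err m * norm1 u)%Z in
  Model u (2 * d * norm1 u / (S * S) + 1) (valid m && (2 * d <=? S * S)%Z).

(** With [s = sqrt y], the error [|s S - u|] is [|y S^2 - u^2| / (s S + u)], and the denominator is
    at least [u], hence at least [coef_lower u]. *)
Definition msqrt (m : model) (u : list Z) : model :=
  let d := (norm1 (psub (pscale S (coefs m)) (pmul u u)) + S * err m)%Z in
  Model u (d / coef_lower u + 1) (valid m && (0 <? coef_lower u)%Z).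

Definition mbound (m : model) : Z := norm1 (coefs m) + err m.

Lemma IZR_div_succ (a d : Z) : (0 < d)%Z -> IZR a / IZR d <= IZR (a / d + 1).
Proof.
intros Hd; assert (Hd' := IZR_lt _ _ Hd).
apply Rmult_le_reg_r with (IZR d); [lra|].
replace (IZR a / IZR d * IZR d) with (IZR a) by (field; lra).
rewrite <- mult_IZR; apply IZR_le.
assert (H := Z.div_mod a d ltac:(lia)).
assert (H1 := Z.mod_pos_bound a d Hd); nia.
Qed.

Lemma round_to_encloses d e l v y :
  (v = true -> (0 < d)%Z /\ Rabs (y * IZR S * IZR d - peval l x) <= IZR e) ->
  encloses S x (round_to d e l v) y.
Proof.
unfold encloses, round_to; simpl; intros H Hv.
destruct (H Hv) as [Hd He].
set (low := map _ _).
assert (Hd' := IZR_lt _ _ Hd).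
eapply Rle_trans; [|apply IZR_div_succ, Hd].
apply Rmult_le_reg_r with (IZR d); [lra|].
match goal with |- _ <= ?a / ?b * ?b => replace (a / b * b) with a by (field; lra) end.
rewrite <- (Rabs_pos_eq (IZR d)) at 1 by lra.
rewrite <- Rabs_mult.
replace ((y * IZR S - peval low x) * IZR d)
  with ((y * IZR S * IZR d - peval l x) + peval (psub l (pscale d low)) x)
  by (rewrite peval_psub, peval_pscale; ring).
rewrite plus_IZR.
eapply Rle_trans; [apply Rabs_triang|].
apply Rplus_le_compat; [exact He|now apply peval_norm1].
Qed.

Lemma madd_encloses m n y z :
  encloses S x m y -> encloses S x n z -> encloses S x (madd m n) (y + z).
Proof.
intros Hm Hn Hv; simpl in *.
apply Bool.andb_true_iff in Hv; destruct Hv as [Hv1 Hv2].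
specialize (Hm Hv1); specialize (Hn Hv2).
rewrite peval_padd, plus_IZR.
replace (_ - _) with ((y * IZR S - peval (coefs m) x)
  + (z * IZR S - peval (coefs n) x)) by ring.
eapply Rle_trans; [apply Rabs_triang|lra].
Qed.

Lemma mopp_encloses m y : encloses S x m y -> encloses S x (mopp m) (- y).
Proof.
intros Hm Hv; simpl in *; specialize (Hm Hv).
rewrite peval_pscale, <- Rabs_Ropp.
replace (- _) with (y * IZR S - peval (coefs m) x) by ring; exact Hm.
Qed.

Lemma mscale_encloses p d m y :
  encloses S x m y -> encloses S x (mscale p d m) (IZR p / IZR d * y).
Proof.
intros Hm; apply round_to_encloses; intros Hv.
apply Bool.andb_true_iff in Hv; destruct Hv as [Hv1 Hv2].
apply Z.ltb_lt in Hv2; specialize (Hm Hv1); split; [exact Hv2|].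
apply IZR_lt in Hv2.
rewrite peval_pscale, mult_IZR, abs_IZR.
replace (_ - _) with (IZR p * (y * IZR S - peval (coefs m) x)) by (field; lra).
rewrite Rabs_mult; apply Rmult_le_compat_l; [apply Rabs_pos|exact Hm].
Qed.

Lemma mmul_encloses m n y z :
  encloses S x m y -> encloses S x n z -> encloses S x (mmul m n) (y * z).
Proof.
intros Hm Hn; apply round_to_encloses; intros Hv.
apply Bool.andb_true_iff in Hv; destruct Hv as [Hv1 Hv2].
specialize (Hm Hv1); specialize (Hn Hv2); split; [exact S_pos|].
rewrite peval_pmul, !plus_IZR, !mult_IZR.
assert (H1 := peval_norm1 (coefs m) x x_unit).
assert (H2 := peval_norm1 (coefs n) x x_unit).
set (P := peval _ _) in *; set (Q := peval (coefs n) _) in *.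
replace (_ - _) with (P * (z * IZR S - Q) + Q * (y * IZR S - P)
  + (y * IZR S - P) * (z * IZR S - Q)) by ring.
eapply Rle_trans; [apply Rabs_triang|apply Rplus_le_compat].
  eapply Rle_trans; [apply Rabs_triang|rewrite !Rabs_mult].
  apply Rplus_le_compat; apply Rmult_le_compat; auto using Rabs_pos.
rewrite Rabs_mult; apply Rmult_le_compat; auto using Rabs_pos.
Qed.

Lemma minv_encloses m u y :
  encloses S x m y ->
  encloses S x (minv m u) (/ y) /\ (valid (minv m u) = true -> y <> 0).
Proof.
intros Hm.
assert (main : valid (minv m u) = true -> y <> 0 /\
  Rabs (/ y * IZR S - peval u x) <= IZR (err (minv m u))).
  intros Hv; cbn [minv msqrt valid err coefs] in *.
  apply Bool.andb_true_iff in Hv; destruct Hv as [Hv1 Hv2].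
  apply Z.leb_le in Hv2; specialize (Hm Hv1).
  set (d := (_ + _)%Z) in *.
  apply IZR_le in Hv2; rewrite !mult_IZR in Hv2.
  assert (Hu := peval_norm1 u x x_unit).
  set (U := peval u x) in *.
  assert (Hd : Rabs (IZR S * IZR S - y * IZR S * U) <= IZR d).
    replace (_ - _) with (peval (psub (S * S :: nil)%Z (pmul (coefs m) u)) x
      - (y * IZR S - peval (coefs m) x) * U).
      2:{ rewrite peval_psub, peval_pmul; fold U; simpl; rewrite mult_IZR; ring. }
    unfold d; rewrite plus_IZR, mult_IZR.
    eapply Rle_trans; [apply Rabs_triang|apply Rplus_le_compat].
      now apply peval_norm1.
    rewrite Rabs_Ropp, Rabs_mult; apply Rmult_le_compat; auto using Rabs_pos.
  assert (Hy : IZR S <= 2 * (Rabs y * Rabs U)).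
    assert (H := Rabs_triang_inv (IZR S * IZR S) (y * IZR S * U)).
    rewrite (Rabs_pos_eq (IZR S * IZR S)) in H by nra.
    rewrite !Rabs_mult, (Rabs_pos_eq (IZR S)) in H by lra.
    apply Rmult_le_reg_r with (IZR S); [exact IZR_S_pos|].
    replace (2 * (Rabs y * Rabs U) * IZR S) with (2 * (Rabs y * IZR S * Rabs U)) by ring.
    lra.
  assert (y0 : y <> 0).
    intros ->; rewrite Rabs_R0 in Hy; lra.
  split; [exact y0|].
  assert (y_pos := Rabs_pos_lt y y0).
  eapply Rle_trans; [|apply IZR_div_succ; nia].
  rewrite !mult_IZR.
  apply Rmult_le_reg_r with (IZR S * IZR S * Rabs y); [apply Rmult_lt_0_compat; nra|].
  replace (Rabs (/ y * IZR S - U) * (IZR S * IZR S * Rabs y))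
    with (Rabs (IZR S * IZR S - y * IZR S * U) * IZR S).
    2:{ replace (IZR S * IZR S - y * IZR S * U) with (y * IZR S * (/ y * IZR S - U))
          by (field; exact y0).
        rewrite !Rabs_mult, (Rabs_pos_eq (IZR S)) by lra; ring. }
  replace (2 * IZR d * IZR (norm1 u) / (IZR S * IZR S) * (IZR S * IZR S * Rabs y))
    with (IZR d * (2 * (Rabs y * IZR (norm1 u)))) by (field; lra).
  apply Rmult_le_compat; [apply Rabs_pos|lra|exact Hd|].
  assert (Rabs y * Rabs U <= Rabs y * IZR (norm1 u))
    by (apply Rmult_le_compat_l; lra).
  lra.
split; intros Hv; now apply main.
Qed.

Lemma msqrt_encloses m u y :
  0 <= y -> encloses S x m y -> encloses S x (msqrt m u) (sqrt y).
Proof.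
intros Hy Hm Hv; cbn [minv msqrt valid err coefs] in *.
apply Bool.andb_true_iff in Hv; destruct Hv as [Hv1 Hv2].
apply Z.ltb_lt in Hv2; specialize (Hm Hv1).
eapply Rle_trans; [|apply IZR_div_succ, Hv2].
apply IZR_lt in Hv2.
assert (Hl := peval_coef_lower u x x_unit).
assert (Hs := sqrt_pos y).
assert (Hss := sqrt_sqrt y Hy).
set (U := peval u x) in *; set (s := sqrt y) in *.
apply Rmult_le_reg_r with (IZR (coef_lower u)); [lra|].
match goal with |- _ <= ?a / ?b * ?b => replace (a / b * b) with a by (field; lra) end.
apply Rle_trans with (Rabs (s * IZR S - U) * (s * IZR S + U)).
  apply Rmult_le_compat_l; [apply Rabs_pos|nra].
rewrite <- (Rabs_pos_eq (s * IZR S + U)) by nra.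
rewrite <- Rabs_mult.
replace ((s * IZR S - U) * (s * IZR S + U))
  with (peval (psub (pscale S (coefs m)) (pmul u u)) x
        + IZR S * (y * IZR S - peval (coefs m) x)).
  2:{ rewrite peval_psub, peval_pmul, peval_pscale, <- Hss; fold U; ring. }
rewrite plus_IZR, mult_IZR.
eapply Rle_trans; [apply Rabs_triang|apply Rplus_le_compat].
  now apply peval_norm1.
rewrite Rabs_mult, (Rabs_pos_eq (IZR S)) by lra.
apply Rmult_le_compat_l; lra.
Qed.

Lemma mbound_bounds m y :
  encloses S x m y -> valid m = true -> Rabs y * IZR S <= IZR (mbound m).
Proof.
intros Hm Hv; specialize (Hm Hv).
unfold mbound; rewrite plus_IZR.
assert (H := peval_norm1 (coefs m) x x_unit).
rewrite <- (Rabs_pos_eq (IZR S)) by lra; rewrite <- Rabs_mult.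
replace (y * IZR S) with (peval (coefs m) x + (y * IZR S - peval (coefs m) x)) by ring.
eapply Rle_trans; [apply Rabs_triang|lra].
Qed.

(* Slopes of [y] between two points whose coordinates differ by [d1], ..., [d5]. *)
Record slopes : Type := Slopes { sl1 : model; sl2 : model; sl3 : model; sl4 : model; sl5 : model }.

Definition smap (g : model -> model) (s : slopes) : slopes :=
  Slopes (g (sl1 s)) (g (sl2 s)) (g (sl3 s)) (g (sl4 s)) (g (sl5 s)).

Definition smap2 (g : model -> model -> model) (s t : slopes) : slopes :=
  Slopes (g (sl1 s) (sl1 t)) (g (sl2 s) (sl2 t)) (g (sl3 s) (sl3 t))
         (g (sl4 s) (sl4 t)) (g (sl5 s) (sl5 t)).

Variables d1 d2 d3 d4 d5 : R.

Definition encloses_slopes (s : slopes) (dy : R) : Prop :=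
  exists z1 z2 z3 z4 z5, dy = z1 * d1 + z2 * d2 + z3 * d3 + z4 * d4 + z5 * d5 /\
    encloses S x (sl1 s) z1 /\ encloses S x (sl2 s) z2 /\ encloses S x (sl3 s) z3 /\
    encloses S x (sl4 s) z4 /\ encloses S x (sl5 s) z5.

Lemma smap_encloses g c s dy :
  (forall m y, encloses S x m y -> encloses S x (g m) (c * y)) ->
  encloses_slopes s dy -> encloses_slopes (smap g s) (c * dy).
Proof.
intros Hg (z1 & z2 & z3 & z4 & z5 & E & H1 & H2 & H3 & H4 & H5).
exists (c * z1), (c * z2), (c * z3), (c * z4), (c * z5).
split; [rewrite E; ring|simpl; auto 10].
Qed.

Lemma smap2_madd_encloses s t dy dz :
  encloses_slopes s dy -> encloses_slopes t dz ->
  encloses_slopes (smap2 madd s t) (dy + dz).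
Proof.
intros (z1 & z2 & z3 & z4 & z5 & E & H1 & H2 & H3 & H4 & H5).
intros (w1 & w2 & w3 & w4 & w5 & F & K1 & K2 & K3 & K4 & K5).
exists (z1 + w1), (z2 + w2), (z3 + w3), (z4 + w4), (z5 + w5).
split; [rewrite E, F; ring|simpl; auto 10 using madd_encloses].
Qed.

(** Slopes are finite differences, not derivatives: [y - y'] is an exact combination of the
    increments, so no mean value theorem is involved. Both points lie in the same box, so a single
    value model encloses [y] and [y'] and can stand for either in the product and quotient rules. *)
Record jet : Type := Jet { val : model; slo : slopes }.

Definition encloses_jet (j : jet) (y y' : R) : Prop :=
  encloses S x (val j) y /\ encloses S x (val j) y' /\
  encloses_slopes (slo j) (y - y').

Definition jadd (j k : jet) : jet :=
  Jet (madd (val j) (val k)) (smap2 madd (slo j) (slo k)).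

Definition jscale (p d : Z) (j : jet) : jet :=
  Jet (mscale p d (val j)) (smap (mscale p d) (slo j)).

Definition jmul (j k : jet) : jet :=
  Jet (mmul (val j) (val k))
    (smap2 madd (smap (mmul (val j)) (slo k)) (smap (mmul (val k)) (slo j))).

Definition jinv (j : jet) (u : list Z) : jet :=
  let v := minv (val j) u in
  Jet v (smap (mmul (mopp (mmul v v))) (slo j)).

Definition jsqrt (j : jet) (u w : list Z) : jet :=
  let v := msqrt (val j) u in
  Jet v (smap (mmul (minv (madd v v) w)) (slo j)).

Lemma jadd_encloses j k y y' z z' :
  encloses_jet j y y' -> encloses_jet k z z' ->
  encloses_jet (jadd j k) (y + z) (y' + z').
Proof.
intros (H1 & H2 & H3) (K1 & K2 & K3); repeat split; simpl; auto using madd_encloses.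
replace (_ - _) with ((y - y') + (z - z')) by ring.
now apply smap2_madd_encloses.
Qed.

Lemma jscale_encloses p d j y y' :
  encloses_jet j y y' ->
  encloses_jet (jscale p d j) (IZR p / IZR d * y) (IZR p / IZR d * y').
Proof.
intros (H1 & H2 & H3); repeat split; simpl; auto using mscale_encloses.
replace (_ - _) with (IZR p / IZR d * (y - y')) by ring.
apply smap_encloses; auto using mscale_encloses.
Qed.

Lemma jmul_encloses j k y y' z z' :
  encloses_jet j y y' -> encloses_jet k z z' ->
  encloses_jet (jmul j k) (y * z) (y' * z').
Proof.
intros (H1 & H2 & H3) (K1 & K2 & K3); repeat split; simpl; auto using mmul_encloses.
replace (_ - _) with (y * (z - z') + z' * (y - y')) by ring.
apply smap2_madd_encloses; apply smap_encloses; auto using mmul_encloses.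
Qed.

Lemma jinv_encloses j u y y' :
  y <> 0 -> y' <> 0 -> encloses_jet j y y' ->
  encloses_jet (jinv j u) (/ y) (/ y').
Proof.
intros Hy Hy' (H1 & H2 & H3).
destruct (minv_encloses _ u _ H1) as [I1 _].
destruct (minv_encloses _ u _ H2) as [I2 _].
split; [exact I1|split; [exact I2|]].
replace (_ - _) with (- (/ y * / y') * (y - y')) by (field; auto).
apply smap_encloses; auto.
intros; apply mmul_encloses; auto; apply mopp_encloses; now apply mmul_encloses.
Qed.

Lemma jsqrt_encloses j u w y y' :
  0 < y -> 0 < y' -> encloses_jet j y y' ->
  encloses_jet (jsqrt j u w) (sqrt y) (sqrt y').
Proof.
intros Hy Hy' (H1 & H2 & H3).
assert (I1 := msqrt_encloses _ u _ (Rlt_le _ _ Hy) H1).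
assert (I2 := msqrt_encloses _ u _ (Rlt_le _ _ Hy') H2).
split; [exact I1|split; [exact I2|]].
assert (P := sqrt_lt_R0 _ Hy); assert (P' := sqrt_lt_R0 _ Hy').
replace (_ - _) with (/ (sqrt y + sqrt y') * (y - y')).
  2:{ rewrite <- (sqrt_sqrt y) at 2 by lra; rewrite <- (sqrt_sqrt y') at 2 by lra.
      field; lra. }
apply smap_encloses; auto.
intros; apply mmul_encloses; auto.
now apply minv_encloses, madd_encloses.
Qed.

End ModelArithmetic.

(** * The rescaled equations *)

(* [2 ^ 48] and [2 ^ 30]. *)
Definition Sp : Z := 281474976710656.
Definition Sv : Z := 1073741824.

(* Approximations in [x = 2 tau - 1], over [Sp], of the Taylor series at [tau = 1/2] of
   [f / 10], [r / 10], [theta] ([p1], [p2], [p3]), computed in floating point. [vij], over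
   [Sv], approximates the derivative of the i-th of them with respect to the j-th shooting
   parameter; the parameters are normalised so that the terminal data
   [(f', r', theta)(tau = 1)] have the identity as derivative. The coefficients of degree at
   most 2 are adjusted to make this identity, the initial conditions and the conditions
   [f' = r' = 0] at [tau = 1] hold exactly. [bqj] and [bmj] are the derivatives of [q] and [m]
   with respect to the parameters, and [q0], [m0] their central values. *)
Definition p1 : list Z := (49844081677380 :: 38181927482878 :: (-16071894783620) ::
  (-3288167238550) :: 1109148782710 :: (-97665086158) :: (-52665382616) :: 33552255940 ::
  (-3393366234) :: (-2941210303) :: 1561457559 :: (-136938567) :: (-190694032) :: 92372773
  :: (-4437854) :: (-13676384) :: 6047959 :: (-6714) :: (-1053446) :: 418189 :: 22418 ::
  (-84643) :: 29882 :: 3554 :: (-6988) :: 2171 :: 432 :: (-587) :: 158 :: 48 :: (-50) ::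
  11 :: nil)%Z.
Definition p2 : list Z := (273696107792006 :: (-12080780066575) :: 200390776756 ::
  4943022909824 :: (-162895104653) :: (-582284730671) :: 51088510145 :: 19969656474 ::
  (-7278593758) :: 3437000824 :: 78521735 :: (-763027197) :: 185110812 :: 55999717 ::
  (-40273419) :: 8243605 :: 2896770 :: (-2955178) :: 631385 :: 312384 :: (-223710) ::
  31611 :: 26177 :: (-16683) :: 2040 :: 2363 :: (-1343) :: 92 :: 215 :: (-105) :: 2 :: 19
  :: nil)%Z.
Definition p3 : list Z := (165790676584400 :: 171790639218782 :: 7582734539442 ::
  250844543298 :: (-1544846204488) :: (-123318477075) :: 116523432621 :: 28538736553 ::
  (-1004129530) :: (-3671160435) :: (-959131178) :: 243249655 :: 169061095 :: 6219207 ::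
  (-15874987) :: (-4262167) :: 258115 :: 694134 :: 192867 :: (-70001) :: (-36012) :: 2836
  :: 2890 :: 686 :: 104 :: (-218) :: (-58) :: 35 :: 6 :: (-3) :: 0 :: 0 :: nil)%Z.
Definition v11 : list Z := (3971402944 :: 3030831695 :: (-1196831344) :: (-114994318) ::
  111147840 :: (-43023536) :: (-3590810) :: 7938880 :: (-2439681) :: (-381257) :: 607452
  :: (-171462) :: (-42832) :: 50039 :: (-12424) :: (-4557) :: 4309 :: (-900) :: (-477) ::
  379 :: (-63) :: (-49) :: nil)%Z.
Definition v12 : list Z := ((-1270597784) :: (-952056911) :: 418131818 :: 60507709 ::
  (-30367725) :: 12296351 :: 890454 :: (-2318164) :: 671225 :: 105439 :: (-172495) ::
  48414 :: 12222 :: (-14131) :: 3510 :: 1292 :: (-1218) :: 254 :: 135 :: (-107) :: 18 ::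
  14 :: nil)%Z.
Definition v13 : list Z := (2163702920 :: 1579418554 :: (-749366221) :: (-80277153) ::
  67997305 :: (-24293182) :: (-2041061) :: 4667916 :: (-1395880) :: (-225567) :: 350896 ::
  (-98435) :: (-25028) :: 28820 :: (-7110) :: (-2640) :: 2478 :: (-514) :: (-275) :: 217
  :: (-36) :: (-28) :: nil)%Z.
Definition v21 : list Z := ((-1177530939) :: (-1820423806) :: 34912745 :: 729721027 ::
  (-33185206) :: (-73795857) :: 12469338 :: (-1753221) :: (-1334180) :: 1707224 ::
  (-232125) :: (-270327) :: 111051 :: 1602 :: (-17482) :: 8585 :: (-261) :: (-1813) :: 756
  :: 60 :: (-165) :: 58 :: nil)%Z.
Definition v22 : list Z := (566521654 :: 952223120 :: 148496178 :: (-267936707) ::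
  (-5740622) :: 23449707 :: (-1294665) :: 1005020 :: 232812 :: (-572814) :: 58944 :: 84849
  :: (-28319) :: (-767) :: 4472 :: (-2507) :: 111 :: 533 :: (-213) :: (-20) :: 46 :: (-16)
  :: nil)%Z.
Definition v23 : list Z := ((-682671861) :: (-1050376028) :: 30300112 :: 425783440 ::
  (-24310011) :: (-45771026) :: 7205618 :: (-755499) :: (-729868) :: 980788 :: (-139207)
  :: (-157498) :: 64583 :: 1364 :: (-10099) :: 4887 :: (-152) :: (-1041) :: 436 :: 36 ::
  (-95) :: 33 :: nil)%Z.
Definition v31 : list Z := ((-955484521) :: (-54800922) :: 1172828462 :: 88699582 ::
  (-231101365) :: (-41753886) :: 12734758 :: 8816044 :: 1441785 :: (-999318) :: (-484666)
  :: 28879 :: 70474 :: 12239 :: (-4612) :: (-2987) :: (-467) :: 400 :: 176 :: (-29) ::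
  (-24) :: (-2) :: nil)%Z.
Definition v32 : list Z := (533769893 :: 96114138 :: (-609134180) :: (-115971909) ::
  77369170 :: 23360100 :: (-1139745) :: (-3798943) :: (-1061249) :: 287568 :: 219889 ::
  16042 :: (-24765) :: (-8211) :: 718 :: 1333 :: 340 :: (-121) :: (-80) :: 1 :: 9 :: 2 ::
  nil)%Z.
Definition v33 : list Z := ((-32755375) :: 507801669 :: 700616090 :: 47724249 ::
  (-140122195) :: (-23368045) :: 8630349 :: 5319595 :: 746181 :: (-635403) :: (-284001) ::
  23630 :: 43080 :: 6783 :: (-3072) :: (-1796) :: (-233) :: 250 :: 102 :: (-19) :: (-14)
  :: (-1) :: nil)%Z.
Definition inv_r_approx : list Z := (289474933178334 :: 12777247841301 :: 352036479556 ::
  (-5221808981456) :: (-289219494663) :: 608157956057 :: 94721840745 :: (-16905772436) ::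
  (-16380280127) :: (-5021021221) :: 1646758566 :: 1131298213 :: (-70739389) ::
  (-120869503) :: (-10975809) :: 1191841 :: 3979436 :: 2019536 :: (-811229) :: (-349441)
  :: 111959 :: 12537 :: (-4504) :: 6071 :: (-2628) :: (-1219) :: 819 :: 2 :: (-106) :: 43
  :: (-4) :: (-9) :: nil)%Z.
Definition s_approx : list Z := (291285580373333 :: 14783120947311 :: (-927226488713) ::
  (-5994233673915) :: 753417720947 :: 646126914119 :: (-235899507489) :: 9837753520 ::
  33353690053 :: (-13756440096) :: (-257265921) :: 2307813302 :: (-863832336) ::
  (-64218838) :: 177111299 :: (-58746336) :: (-8598711) :: 14242406 :: (-4152765) ::
  (-979571) :: 1182515 :: (-297097) :: (-104542) :: 100199 :: (-21071) :: (-10795) :: 8594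
  :: (-1448) :: (-1093) :: 742 :: (-93) :: (-109) :: nil)%Z.
Definition inv_s_approx : list Z := (271994797726409 :: (-13804088711413) :: 1566395060296
  :: 5473819367524 :: (-1260406932248) :: (-454005851006) :: 378517794175 ::
  (-84591115887) :: (-42136692636) :: 32434831183 :: (-5289648943) :: (-4161318548) ::
  2800529457 :: (-332033002) :: (-422445427) :: 245175836 :: (-17489802) :: (-42690835) ::
  21656213 :: (-408957) :: (-4295653) :: 1912580 :: 76231 :: (-430231) :: 167866 :: 18070
  :: (-42848) :: 14565 :: 2750 :: (-4241) :: 1242 :: 360 :: nil)%Z.
Definition q0 : Z := 2011689049313382.
Definition m0 : Z := 324853200883663.
Definition bq1 : Z := 22916925090.
Definition bq2 : Z := -8045888189.
Definition bq3 : Z := 23864756297.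
Definition bm1 : Z := -2898877938.
Definition bm2 : Z := 1526572676.
Definition bm3 : Z := -660297907.
(* The equations in the variables [tau = t / T], [f / 10], [r / 10], where [q = T ^ 2] and
   [m = a T / 10]. *)
Definition sep (f r : R) : R := sqrt (r ^ 2 + 4 * f ^ 2).

Definition acc_f (q f r : R) : R := - (2 / 5) * q * f / sep f r ^ 3.

Definition acc_r (q m f r : R) : R :=
  m ^ 2 / r ^ 3 - q * (1 / 40 / r ^ 2 + 1 / 5 * r / sep f r ^ 3).

Definition rate_th (m r : R) : R := m / r ^ 2.

Record jet3 : Type := Jet3 { jet_f : jet; jet_r : jet; jet_th : jet }.

(** The lists [cv], [cs], [ch], [cu] are the guesses for [1 / r], [s], [1 / (2 s)] and [1 / s],
    where [s] is the separation; [ch] serves the slope [1 / (s + s')] of the square root. *)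
Definition rate_jets (S : Z) (N : nat) (q m f r : jet) (cv cs ch cu : list Z) : jet3 :=
  let mul := jmul S N in
  let v := jinv S N r cv in
  let s := jsqrt S N (jadd (mul r r) (jscale N 4 1 (mul f f))) cs ch in
  let u := jinv S N s cu in
  let u3 := mul u (mul u u) in
  let v2 := mul v v in
  Jet3 (jscale N (-2) 5 (mul q (mul f u3)))
    (jadd (mul (mul m m) (mul v v2))
       (jscale N (-1) 1
          (mul q (jadd (jscale N 1 40 v2) (jscale N 1 5 (mul r u3))))))
    (mul m v2).

Lemma sep_arg_pos f r : 0 < r -> 0 < r ^ 2 + 4 * f ^ 2.
Proof. intros; nra. Qed.

Lemma sep_pos f r : 0 < r -> 0 < sep f r.
Proof. intros; now apply sqrt_lt_R0, sep_arg_pos. Qed.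

Lemma encloses_jet_eq S x d1 d2 d3 d4 d5 j y y' z z' :
  y = z -> y' = z' -> encloses_jet S x d1 d2 d3 d4 d5 j y y' ->
  encloses_jet S x d1 d2 d3 d4 d5 j z z'.
Proof. now intros -> ->. Qed.

Lemma rate_jets_enclose S N x d1 d2 d3 d4 d5 q m f r cv cs ch cu yq ym yf yr zq zm zf zr :
  (0 < S)%Z -> Rabs x <= 1 -> 0 < yr -> 0 < zr ->
  let enc := encloses_jet S x d1 d2 d3 d4 d5 in
  let J := rate_jets S N q m f r cv cs ch cu in
  enc q yq zq -> enc m ym zm -> enc f yf zf -> enc r yr zr ->
  enc (jet_f J) (acc_f yq yf yr) (acc_f zq zf zr) /\
  enc (jet_r J) (acc_r yq ym yf yr) (acc_r zq zm zf zr) /\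
  enc (jet_th J) (rate_th ym yr) (rate_th zm zr).
Proof.
intros HS Hx Hy Hz enc J Hq Hm Hf Hr.
assert (Dy := sep_pos yf yr Hy); assert (Dz := sep_pos zf zr Hz).
assert (mul : forall j k y y' z z', enc j y y' -> enc k z z' ->
  enc (jmul S N j k) (y * z) (y' * z')) by (intros; now apply jmul_encloses).
assert (scl : forall p d j y y', enc j y y' ->
  enc (jscale N p d j) (IZR p / IZR d * y) (IZR p / IZR d * y'))
  by (intros; now apply jscale_encloses).
assert (add : forall j k y y' z z', enc j y y' -> enc k z z' ->
  enc (jadd j k) (y + z) (y' + z')) by (intros; now apply jadd_encloses).
assert (Hv : enc (jinv S N r cv) (/ yr) (/ zr))
  by (apply jinv_encloses; auto; now apply Rgt_not_eq).
assert (Hs : enc (jsqrt S N (jadd (jmul S N r r) (jscale N 4 1 (jmul S N f f))) cs ch)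
  (sep yf yr) (sep zf zr)).
  assert (E : forall a b, b ^ 2 + 4 * a ^ 2 = b * b + 4 / 1 * (a * a))
    by (intros; field).
  apply (sep_arg_pos yf) in Hy; apply (sep_arg_pos zf) in Hz.
  unfold sep; rewrite (E yf yr) in Hy |- *; rewrite (E zf zr) in Hz |- *.
  apply jsqrt_encloses; try assumption.
  apply add; [|apply scl]; apply mul; assumption.
set (s := jsqrt _ _ _ _ _) in Hs.
assert (Hu : enc (jinv S N s cu) (/ sep yf yr) (/ sep zf zr))
  by (apply jinv_encloses; auto; now apply Rgt_not_eq).
unfold J, rate_jets, acc_f, acc_r, rate_th; cbn zeta; fold s; cbn [jet_f jet_r jet_th].
set (dy := sep yf yr) in *; set (dz := sep zf zr) in *.
split; [|split].
- eapply encloses_jet_eq; cycle -1; [apply scl, mul; [exact Hq|apply mul; [exact Hf|]];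
    repeat apply mul; exact Hu|..]; field; lra.
- eapply encloses_jet_eq; cycle -1;
    [apply add; [repeat apply mul; eassumption|apply scl, mul;
      [exact Hq|apply add; apply scl; repeat apply mul; eassumption]]|..]; field; lra.
- eapply encloses_jet_eq; cycle -1; [repeat apply mul; eassumption|..]; field; lra.
Qed.

(** * Enclosure of the residual *)

(** [e1], [e2] are the remainders of [f] and [r] at one instant, [a1], [a2], [a3] the shooting
    parameters. The remainder of the angle is absent because the right-hand sides do not depend on
    the angle. *)
Record point : Type := Point { e1 : R; e2 : R; a1 : R; a2 : R; a3 : R }.

Definition origin : point := Point 0 0 0 0 0.

(* Radii of the box, in units of [1 / Sv]. *)
Definition in_box (z : point) : Prop :=
  Rabs (e1 z) * IZR Sv <= 26 /\ Rabs (e2 z) * IZR Sv <= 26 /\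
  Rabs (a1 z) * IZR Sv <= 104 /\ Rabs (a2 z) * IZR Sv <= 104 /\
  Rabs (a3 z) * IZR Sv <= 52.

Definition curve (p w1 w2 w3 : list Z) (z : point) (x : R) : R :=
  peval p x / IZR Sp +
  (peval w1 x * a1 z + peval w2 x * a2 z + peval w3 x * a3 z) / IZR Sv.

Definition pderiv2 (l : list Z) : list Z := pderiv (pderiv l).

(** Written as a curve with constant polynomials so that the enclosure of curves applies to it
    unchanged; the evaluation point 0 is arbitrary. *)
Definition par_q (z : point) : R := curve (q0 :: nil) (bq1 :: nil) (bq2 :: nil) (bq3 :: nil) z 0.

Definition par_m (z : point) : R := curve (m0 :: nil) (bm1 :: nil) (bm2 :: nil) (bm3 :: nil) z 0.

Definition pos_f (z : point) (x : R) : R := curve p1 v11 v12 v13 z x + e1 z.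

Definition pos_r (z : point) (x : R) : R := curve p2 v21 v22 v23 z x + e2 z.

(* The factors 4 and 2 are [(dx/dtau)^2] and [dx/dtau] for [x = 2 tau - 1]. *)
Definition residual_f (z : point) (x : R) : R :=
  acc_f (par_q z) (pos_f z x) (pos_r z x)
  - 4 * curve (pderiv2 p1) (pderiv2 v11) (pderiv2 v12) (pderiv2 v13) z x.

Definition residual_r (z : point) (x : R) : R :=
  acc_r (par_q z) (par_m z) (pos_f z x) (pos_r z x)
  - 4 * curve (pderiv2 p2) (pderiv2 v21) (pderiv2 v22) (pderiv2 v23) z x.

Definition residual_th (z : point) (x : R) : R :=
  rate_th (par_m z) (pos_r z x)
  - 2 * curve (pderiv p3) (pderiv v31) (pderiv v32) (pderiv v33) z x.

Definition exact (l : list Z) : model := Model l 0 true.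

Definition jconst (m : model) : jet :=
  Jet m (Slopes (exact nil) (exact nil) (exact nil) (exact nil) (exact nil)).

Definition ball (n : Z) : model := Model nil n true.

Definition mone : model := exact (Sv :: nil).

Definition jet_e1 : jet :=
  Jet (ball 26) (Slopes mone (exact nil) (exact nil) (exact nil) (exact nil)).
Definition jet_e2 : jet :=
  Jet (ball 26) (Slopes (exact nil) mone (exact nil) (exact nil) (exact nil)).
Definition jet_a1 : jet :=
  Jet (ball 104) (Slopes (exact nil) (exact nil) mone (exact nil) (exact nil)).
Definition jet_a2 : jet :=
  Jet (ball 104) (Slopes (exact nil) (exact nil) (exact nil) mone (exact nil)).
Definition jet_a3 : jet :=
  Jet (ball 52) (Slopes (exact nil) (exact nil) (exact nil) (exact nil) mone).

Definition jet_curve (N : nat) (p w1 w2 w3 : list Z) : jet :=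
  let mul := jmul Sv N in
  jadd (jconst (round_to N (Sp / Sv) 0 p true))
    (jadd (jadd (mul (jconst (exact w1)) jet_a1) (mul (jconst (exact w2)) jet_a2))
          (mul (jconst (exact w3)) jet_a3)).

Definition residual_jets (S : Z) (N : nat) (q m f r df dr dth : jet)
    (cv cs ch cu : list Z) : jet3 :=
  let J := rate_jets S N q m f r cv cs ch cu in
  Jet3 (jadd (jet_f J) (jscale N (-4) 1 df)) (jadd (jet_r J) (jscale N (-4) 1 dr))
       (jadd (jet_th J) (jscale N (-2) 1 dth)).

(** Passes from scale [Sp] to scale [Sv]. No error has to be tracked: the results are only guesses,
    which [minv] and [msqrt] verify. *)
Definition shrink (N : nat) (l : list Z) : list Z :=
  map (fun a => (a / (Sp / Sv))%Z) (firstn N l).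

Definition box_jet_r : jet := jadd (jet_curve 20 p2 v21 v22 v23) jet_e2.

Definition box_jets : jet3 :=
  let N := 20%nat in
  let cu := shrink N inv_s_approx in
  residual_jets Sv N
    (jet_curve N (q0 :: nil) (bq1 :: nil) (bq2 :: nil) (bq3 :: nil))
    (jet_curve N (m0 :: nil) (bm1 :: nil) (bm2 :: nil) (bm3 :: nil))
    (jadd (jet_curve N p1 v11 v12 v13) jet_e1) box_jet_r
    (jet_curve N (pderiv2 p1) (pderiv2 v11) (pderiv2 v12) (pderiv2 v13))
    (jet_curve N (pderiv2 p2) (pderiv2 v21) (pderiv2 v22) (pderiv2 v23))
    (jet_curve N (pderiv p3) (pderiv v31) (pderiv v32) (pderiv v33))
    (shrink N inv_r_approx) (shrink N s_approx) (map (fun a => a / 2)%Z cu) cu.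

(** The defect of the model must be a fraction of the unit [1 / Sv], so it is evaluated at the finer
    scale [Sp] with 32 coefficients; for the slopes over the box, scale [Sv] and 20 coefficients
    suffice. *)
Definition origin_jets : jet3 :=
  let ex l := jconst (exact l) in
  residual_jets Sp 32 (ex (q0 :: nil)) (ex (m0 :: nil)) (ex p1) (ex p2)
    (ex (pderiv2 p1)) (ex (pderiv2 p2)) (ex (pderiv p3))
    inv_r_approx s_approx (map (fun a => a / 2)%Z inv_s_approx) inv_s_approx.

(* The coefficients [16 * 20] and [16 * 10] are the weights of the parameter increments
   relative to those of the positions in [residual_lipschitz]. *)
Definition slopes_below (j : jet) (k : Z) : bool :=
  let s := slo j in
  (valid (sl1 s) && valid (sl2 s) && valid (sl3 s) && valid (sl4 s) && valid (sl5 s) &&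
   (mbound (sl1 s) + mbound (sl2 s) + 320 * (mbound (sl3 s) + mbound (sl4 s))
    + 160 * mbound (sl5 s) <=? k))%Z%bool.

Definition value_below (j : jet) (k : Z) : bool :=
  (valid (val j) && (mbound (val j) <=? k)%Z)%bool.

(** All the numerical input in one kernel computation. The slope bounds 12 and 6, divided by 16,
    give the contraction ratio 3/4 for the weights 1 and 1/2. The bound 163840 is [5 * 2^15], so
    over [2^48] it is one eighth of [5 / Sv]. The last two conjuncts say that [r] stays positive
    over the box. *)
Lemma certificate :
  (slopes_below (jet_f box_jets) (12 * Sv) && slopes_below (jet_r box_jets) (12 * Sv) &&
   slopes_below (jet_th box_jets) (6 * Sv) &&
   value_below (jet_f origin_jets) 163840 && value_below (jet_r origin_jets) 163840 &&
   value_below (jet_th origin_jets) 81920 && valid (val box_jet_r) &&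
   (err (val box_jet_r) <? coef_lower (coefs (val box_jet_r)))%Z)%bool = true.
Proof. vm_cast_no_check (eq_refl true). Qed.

Definition encl (z z' : point) (x : R) : jet -> R -> R -> Prop :=
  encloses_jet Sv x (e1 z - e1 z') (e2 z - e2 z') (a1 z - a1 z') (a2 z - a2 z') (a3 z - a3 z').

Lemma exact_encloses S x l : (0 < S)%Z -> encloses S x (exact l) (peval l x / IZR S).
Proof.
intros HS _; apply IZR_lt in HS; simpl.
replace (_ - _) with 0 by (field; lra); rewrite Rabs_R0; lra.
Qed.

Lemma exact_nil_encloses S x : encloses S x (exact nil) 0.
Proof. intros _; simpl; rewrite Rmult_0_l, Rminus_0_r, Rabs_R0; lra. Qed.

Lemma mone_encloses x : encloses Sv x mone 1.
Proof.
intros _; simpl; rewrite Rmult_0_r, Rplus_0_r, Rmult_1_l, Rminus_diag, Rabs_R0; lra.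
Qed.

Lemma ball_encloses S x n y : (0 < S)%Z -> Rabs y * IZR S <= IZR n -> encloses S x (ball n) y.
Proof.
intros HS H _; apply IZR_lt in HS; simpl.
rewrite Rminus_0_r, Rabs_mult, (Rabs_pos_eq (IZR S)); lra.
Qed.

Lemma jconst_encloses S x d1 d2 d3 d4 d5 m y :
  encloses S x m y -> encloses_jet S x d1 d2 d3 d4 d5 (jconst m) y y.
Proof.
intros H; split; [exact H|split; [exact H|]].
exists 0, 0, 0, 0, 0; split; [ring|simpl; auto 10 using exact_nil_encloses].
Qed.

Lemma jet_coord_encloses z z' x : in_box z -> in_box z' ->
  encl z z' x jet_e1 (e1 z) (e1 z') /\ encl z z' x jet_e2 (e2 z) (e2 z') /\
  encl z z' x jet_a1 (a1 z) (a1 z') /\ encl z z' x jet_a2 (a2 z) (a2 z') /\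
  encl z z' x jet_a3 (a3 z) (a3 z').
Proof.
intros (B1 & B2 & B3 & B4 & B5) (C1 & C2 & C3 & C4 & C5).
assert (HS : (0 < Sv)%Z) by reflexivity.
repeat split; simpl; try (now apply ball_encloses);
  [exists 1, 0, 0, 0, 0|exists 0, 1, 0, 0, 0|exists 0, 0, 1, 0, 0
  |exists 0, 0, 0, 1, 0|exists 0, 0, 0, 0, 1];
  (split; [ring|simpl; auto 10 using exact_nil_encloses, mone_encloses]).
Qed.

Lemma jet_curve_encloses N z z' x p w1 w2 w3 : Rabs x <= 1 -> in_box z -> in_box z' ->
  encl z z' x (jet_curve N p w1 w2 w3) (curve p w1 w2 w3 z x) (curve p w1 w2 w3 z' x).
Proof.
intros Hx Hz Hz'.
assert (HS : (0 < Sv)%Z) by reflexivity.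
assert (HS' := IZR_lt _ _ HS).
assert (HSp : 0 < IZR Sp) by now apply IZR_lt.
destruct (jet_coord_encloses z z' x Hz Hz') as (_ & _ & H1 & H2 & H3).
eapply encloses_jet_eq; cycle -1; [apply jadd_encloses;
  [apply jconst_encloses|apply jadd_encloses; [apply jadd_encloses|]; apply jmul_encloses;
    try exact HS; try exact Hx; try eassumption; apply jconst_encloses; now apply exact_encloses]
  |..].
- apply round_to_encloses with (y := peval p x / IZR Sp); auto.
  intros _; split; [reflexivity|].
  replace (_ - _) with 0; [rewrite Rabs_R0; lra|].
  rewrite Rmult_assoc, <- mult_IZR; change (Sv * (Sp / Sv))%Z with Sp; field; lra.
- unfold curve; field; lra.
- unfold curve; field; lra.
Qed.

Lemma residual_jets_enclose S N x d1 d2 d3 d4 d5 q m f r df dr dth cv cs ch cu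
    yq ym yf yr ydf ydr ydth zq zm zf zr zdf zdr zdth :
  (0 < S)%Z -> Rabs x <= 1 -> 0 < yr -> 0 < zr ->
  let enc := encloses_jet S x d1 d2 d3 d4 d5 in
  let J := residual_jets S N q m f r df dr dth cv cs ch cu in
  enc q yq zq -> enc m ym zm -> enc f yf zf -> enc r yr zr ->
  enc df ydf zdf -> enc dr ydr zdr -> enc dth ydth zdth ->
  enc (jet_f J) (acc_f yq yf yr - 4 * ydf) (acc_f zq zf zr - 4 * zdf) /\
  enc (jet_r J) (acc_r yq ym yf yr - 4 * ydr) (acc_r zq zm zf zr - 4 * zdr) /\
  enc (jet_th J) (rate_th ym yr - 2 * ydth) (rate_th zm zr - 2 * zdth).
Proof.
intros HS Hx Hy Hz enc J Hq Hm Hf Hr Hdf Hdr Hdth.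
destruct (rate_jets_enclose S N x d1 d2 d3 d4 d5 q m f r cv cs ch cu yq ym yf yr zq zm zf zr)
  as (H1 & H2 & H3); try assumption.
split; [|split]; (eapply encloses_jet_eq; cycle -1;
  [apply jadd_encloses; [eassumption|apply jscale_encloses; eassumption]|..]); field.
Qed.

(** Enclosing the accelerations presupposes [0 < r], so positivity is read off the model of [r]
    alone: its lower bound exceeds its error. *)
Lemma pos_r_positive z x : Rabs x <= 1 -> in_box z -> 0 < pos_r z x.
Proof.
intros Hx Hz.
assert (C := certificate).
apply andb_prop in C; destruct C as [C C2]; apply andb_prop in C; destruct C as [_ C1].
assert (H : encl z z x box_jet_r (pos_r z x) (pos_r z x)).
  apply jadd_encloses; [now apply jet_curve_encloses|now apply jet_coord_encloses].
destruct H as [H _]; specialize (H C1).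
apply Z.ltb_lt, IZR_lt in C2.
assert (L := peval_coef_lower (coefs (val box_jet_r)) x Hx).
apply Rabs_le_between in H.
apply Rmult_lt_reg_r with (IZR Sv); [now apply IZR_lt|lra].
Qed.

Lemma slopes_below_bound z z' x j y y' k D w :
  Rabs x <= 1 -> 0 <= D -> 1 <= w ->
  Rabs (e1 z - e1 z') <= D * w / 16 -> Rabs (e2 z - e2 z') <= D * w / 16 ->
  Rabs (a1 z - a1 z') <= 20 * D -> Rabs (a2 z - a2 z') <= 20 * D ->
  Rabs (a3 z - a3 z') <= 10 * D ->
  encl z z' x j y y' -> slopes_below j (k * Sv) = true ->
  Rabs (y - y') <= IZR k / 16 * (D * w).
Proof.
intros Hx HD Hw E1 E2 A1 A2 A3 (_ & _ & z1 & z2 & z3 & z4 & z5 & E & H1 & H2 & H3 & H4 & H5) C.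
assert (HS : (0 < Sv)%Z) by reflexivity.
unfold slopes_below in C.
repeat (apply andb_prop in C; destruct C as [C ?]).
apply (mbound_bounds Sv x HS Hx) in H1, H2, H3, H4, H5; try assumption.
match goal with K : (_ <=? _)%Z = true |- _ => apply Z.leb_le, IZR_le in K; rename K into L end.
rewrite !plus_IZR, !mult_IZR, plus_IZR in L.
rewrite E.
apply IZR_lt in HS.
set (s := IZR Sv) in *.
assert (T : forall u v b M, Rabs v <= b -> Rabs u * s <= M -> Rabs (u * v) * s <= M * b).
  intros u v b M Hv Hu; rewrite Rabs_mult.
  replace (Rabs u * Rabs v * s) with (Rabs u * s * Rabs v) by ring.
  apply Rmult_le_compat; auto using Rabs_pos.
  apply Rmult_le_pos; [apply Rabs_pos|lra].
specialize (T z1 _ _ _ E1 H1) as T1; specialize (T z2 _ _ _ E2 H2) as T2.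
specialize (T z3 _ _ _ A1 H3) as T3; specialize (T z4 _ _ _ A2 H4) as T4.
specialize (T z5 _ _ _ A3 H5) as T5.
set (u1 := z1 * _) in *; set (u2 := z2 * _) in *; set (u3 := z3 * _) in *.
set (u4 := z4 * _) in *; set (u5 := z5 * _) in *.
assert (TR : Rabs (u1 + u2 + u3 + u4 + u5) <= Rabs u1 + Rabs u2 + Rabs u3 + Rabs u4 + Rabs u5).
  eapply Rle_trans; [apply Rabs_triang|apply Rplus_le_compat_r].
  eapply Rle_trans; [apply Rabs_triang|apply Rplus_le_compat_r].
  eapply Rle_trans; [apply Rabs_triang|apply Rplus_le_compat_r].
  apply Rabs_triang.
apply Rmult_le_reg_r with s; [exact HS|].
apply Rle_trans with ((Rabs u1 + Rabs u2 + Rabs u3 + Rabs u4 + Rabs u5) * s);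
  [apply Rmult_le_compat_r; lra|].
assert (Dw : 0 <= D * w) by nra.
assert (DDw : D <= D * w) by nra.
assert (P : forall v M, Rabs v * s <= M -> 0 <= M).
  intros v M; assert (V := Rabs_pos v); nra.
assert (P3 := P _ _ H3); assert (P4 := P _ _ H4); assert (P5 := P _ _ H5).
set (M1 := IZR (mbound (sl1 _))) in *; set (M2 := IZR (mbound (sl2 _))) in *.
set (M3 := IZR (mbound (sl3 _))) in *; set (M4 := IZR (mbound (sl4 _))) in *.
set (M5 := IZR (mbound (sl5 _))) in *.
(* In units of [D * w / 16], and since [1 <= w], the increments 20 D and 10 D count at most 320 and
   160; these are the weights in [slopes_below]. *)
assert (M3 * (20 * D) <= M3 * (20 * (D * w))) by (apply Rmult_le_compat_l; lra).
assert (M4 * (20 * D) <= M4 * (20 * (D * w))) by (apply Rmult_le_compat_l; lra).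
assert (M5 * (10 * D) <= M5 * (10 * (D * w))) by (apply Rmult_le_compat_l; lra).
assert (F : (D * w) * (M1 + M2 + 320 * (M3 + M4) + 160 * M5) <= (D * w) * (IZR k * s))
  by (apply Rmult_le_compat_l; lra).
lra.
Qed.

Lemma residual_lipschitz z z' x D w :
  Rabs x <= 1 -> in_box z -> in_box z' -> 0 <= D -> 1 <= w ->
  Rabs (e1 z - e1 z') <= D * w / 16 -> Rabs (e2 z - e2 z') <= D * w / 16 ->
  Rabs (a1 z - a1 z') <= 20 * D -> Rabs (a2 z - a2 z') <= 20 * D ->
  Rabs (a3 z - a3 z') <= 10 * D ->
  Rabs (residual_f z x - residual_f z' x) <= 3 / 4 * (D * w) /\
  Rabs (residual_r z x - residual_r z' x) <= 3 / 4 * (D * w) /\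
  Rabs (residual_th z x - residual_th z' x) <= 3 / 4 * (D * w / 2).
Proof.
intros Hx Hz Hz' HD Hw E1 E2 A1 A2 A3.
assert (C := certificate).
do 5 (apply andb_prop in C; destruct C as [C _]).
apply andb_prop in C; destruct C as [C C3]; apply andb_prop in C; destruct C as [C1 C2].
destruct (jet_coord_encloses z z' x Hz Hz') as (I1 & I2 & _).
assert (I : forall N p w1 w2 w3, encl z z' x (jet_curve N p w1 w2 w3)
  (curve p w1 w2 w3 z x) (curve p w1 w2 w3 z' x)) by (intros; now apply jet_curve_encloses).
(* [par_q] and [par_m] are evaluated at 0 while enclosures live at [x]; for constant polynomials the
   two agree. *)
assert (I0 : forall N p w1 w2 w3, (forall y, peval p y = peval p 0) ->
  (forall y, peval w1 y = peval w1 0) -> (forall y, peval w2 y = peval w2 0) ->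
  (forall y, peval w3 y = peval w3 0) -> encl z z' x (jet_curve N p w1 w2 w3)
  (curve p w1 w2 w3 z 0) (curve p w1 w2 w3 z' 0)).
  intros N p w1 w2 w3 Q Q1 Q2 Q3.
  eapply encloses_jet_eq; [| |apply (I N p w1 w2 w3)]; unfold curve;
    now rewrite (Q x), (Q1 x), (Q2 x), (Q3 x).
assert (H : encl z z' x (jet_f box_jets) (residual_f z x) (residual_f z' x) /\
  encl z z' x (jet_r box_jets) (residual_r z x) (residual_r z' x) /\
  encl z z' x (jet_th box_jets) (residual_th z x) (residual_th z' x)).
  unfold box_jets, residual_f, residual_r, residual_th; cbv zeta.
  apply residual_jets_enclose; [reflexivity|exact Hx|now apply pos_r_positive
    |now apply pos_r_positive|apply I0|apply I0| | |apply I|apply I|apply I];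
    try (intros; simpl; ring); apply jadd_encloses; try assumption; apply I.
destruct H as (H1 & H2 & H3).
apply (slopes_below_bound z z' x _ _ _ 12 D w) in H1; try assumption.
apply (slopes_below_bound z z' x _ _ _ 12 D w) in H2; try assumption.
apply (slopes_below_bound z z' x _ _ _ 6 D w) in H3; try assumption.
lra.
Qed.

Lemma residual_origin x : Rabs x <= 1 ->
  Rabs (residual_f origin x) <= 1 / 8 * (5 / IZR Sv) /\
  Rabs (residual_r origin x) <= 1 / 8 * (5 / IZR Sv) /\
  Rabs (residual_th origin x) <= 1 / 8 * (5 / IZR Sv / 2).
Proof.
intros Hx.
assert (C := certificate).
do 2 (apply andb_prop in C; destruct C as [C _]).
apply andb_prop in C; destruct C as [C C3]; apply andb_prop in C; destruct C as [C C2].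
apply andb_prop in C; destruct C as [_ C1].
assert (HS : (0 < Sp)%Z) by reflexivity.
assert (HS' := IZR_lt _ _ HS).
assert (B : in_box origin).
  unfold in_box; simpl; rewrite Rabs_R0, Rmult_0_l; lra.
assert (I : forall p w1 w2 w3 y, (forall s, peval p s = peval p y) \/ x = y ->
  encloses_jet Sp x 0 0 0 0 0 (jconst (exact p))
  (curve p w1 w2 w3 origin y) (curve p w1 w2 w3 origin y)).
  intros p w1 w2 w3 y H; apply jconst_encloses.
  replace (curve p w1 w2 w3 origin y) with (peval p x / IZR Sp);
    [now apply exact_encloses|].
  unfold curve, Rdiv; simpl; rewrite !Rmult_0_r, !Rplus_0_r, Rmult_0_l, Rplus_0_r.
  destruct H as [H| ->]; [now rewrite (H x)|reflexivity].
assert (I0 : forall p w1 w2 w3, encloses_jet Sp x 0 0 0 0 0 (jconst (exact p))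
  (curve p w1 w2 w3 origin x + 0) (curve p w1 w2 w3 origin x + 0)).
  intros; rewrite Rplus_0_r; apply I; now right.
assert (H : let enc := encloses_jet Sp x 0 0 0 0 0 in
  enc (jet_f origin_jets) (residual_f origin x) (residual_f origin x) /\
  enc (jet_r origin_jets) (residual_r origin x) (residual_r origin x) /\
  enc (jet_th origin_jets) (residual_th origin x) (residual_th origin x)).
  intros enc; unfold origin_jets, residual_f, residual_r, residual_th; cbv zeta.
  apply residual_jets_enclose; [reflexivity|exact Hx|now apply pos_r_positive
    |now apply pos_r_positive|apply I; left|apply I; left|apply I0|apply I0
    |apply I|apply I|apply I]; try (now right); intros; simpl; ring.
assert (V : forall j y k, encloses_jet Sp x 0 0 0 0 0 j y y ->
  value_below j k = true -> Rabs y <= IZR k / IZR Sp).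
  intros j y k (E & _ & _) W; apply andb_prop in W; destruct W as [W1 W2].
  apply (mbound_bounds Sp x HS Hx) in E; [|assumption].
  apply Z.leb_le, IZR_le in W2.
  apply Rmult_le_reg_r with (IZR Sp); [lra|].
  replace (IZR k / IZR Sp * IZR Sp) with (IZR k) by (field; lra); lra.
destruct H as (H1 & H2 & H3).
apply V with (1 := H1) in C1; apply V with (1 := H2) in C2; apply V with (1 := H3) in C3.
clear H1 H2 H3; unfold Sp, Sv in *; lra.
Qed.

(** * Fixed points and primitives *)

Lemma geometric_tail (u : nat -> R) (k B : R) :
  0 <= k < 1 -> (forall n, Rabs (u (S n) - u n) <= B * k ^ n) ->
  forall n, Rabs (u n - Lim_seq u) <= B / (1 - k) * k ^ n.
Proof.
intros Hk Hu.
assert (HB : 0 <= B).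
  assert (H := Hu 0%nat); assert (H' := Rabs_pos (u 1%nat - u 0%nat)); simpl in H; lra.
(* The exact partial geometric sum, with its factor [1 - k ^ p], is what makes the induction on [p]
   close. *)
assert (T : forall n p, Rabs (u (n + p)%nat - u n) <= B / (1 - k) * k ^ n * (1 - k ^ p)).
  intros n p; induction p as [|p IH].
    rewrite Nat.add_0_r, Rminus_diag, Rabs_R0; simpl; lra.
  rewrite Nat.add_succ_r.
  replace (_ - _) with ((u (S (n + p)) - u (n + p)%nat) + (u (n + p)%nat - u n)) by ring.
  eapply Rle_trans; [apply Rabs_triang|].
  eapply Rle_trans; [apply Rplus_le_compat; [apply Hu|apply IH]|].
  right; rewrite pow_add; simpl; field; lra.
assert (C : 0 <= B / (1 - k)) by (apply Rmult_le_pos; [lra|left; apply Rinv_0_lt_compat; lra]).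
assert (T' : forall n p, Rabs (u (n + p)%nat - u n) <= B / (1 - k) * k ^ n).
  intros n p; eapply Rle_trans; [apply T|].
  rewrite <- Rmult_1_r; apply Rmult_le_compat_l.
    apply Rmult_le_pos; [exact C|now apply pow_le].
  assert (0 <= k ^ p) by now apply pow_le.
  lra.
assert (K : is_lim_seq (fun n => B / (1 - k) * k ^ n) 0).
  replace (Finite 0) with (Rbar_mult (B / (1 - k)) 0) by (simpl; f_equal; ring).
  apply is_lim_seq_scal_l, is_lim_seq_geom; rewrite Rabs_pos_eq; lra.
assert (L : ex_finite_lim_seq u).
  apply ex_lim_seq_cauchy_corr; intros eps.
  apply is_lim_seq_spec in K; destruct (K (pos_div_2 eps)) as [n0 Hn0].
  exists n0; intros n m Hn Hm.
  specialize (Hn0 n0 (le_n _)); rewrite Rminus_0_r in Hn0; simpl in Hn0.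
  apply Rabs_def2 in Hn0.
  assert (Tn := T' n0 (n - n0)%nat); assert (Tm := T' n0 (m - n0)%nat).
  replace (n0 + (n - n0))%nat with n in Tn by lia.
  replace (n0 + (m - n0))%nat with m in Tm by lia.
  apply Rabs_le_between in Tn; apply Rabs_le_between in Tm.
  apply Rabs_def1; lra.
destruct L as [l Hl]; rewrite (is_lim_seq_unique _ _ Hl); simpl; intros n.
assert (Hn : is_lim_seq (fun p => Rabs (u n - u (n + p)%nat)) (Rabs (u n - l))).
  apply (is_lim_seq_abs _ (Finite (u n - l))).
  apply is_lim_seq_minus'; [apply is_lim_seq_const|].
  apply (is_lim_seq_incr_n u n) in Hl.
  eapply is_lim_seq_ext; [|exact Hl]; intros; simpl; f_equal; lia.
assert (H := is_lim_seq_le _ _ _ (Finite (B / (1 - k) * k ^ n))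
  (fun p => ltac:(rewrite Rabs_minus_sym; apply T')) Hn (is_lim_seq_const _)).
exact H.
Qed.

(** Banach's theorem in a weighted supremum norm, done pointwise: the iterates converge at each [x]
    at a geometric rate proportional to [w x]. The invariant set is abstract and only has to be
    closed under limits with that rate. *)
Lemma weighted_fixed_point {X : Type} (w : X -> R) (good : (X -> R) -> Prop)
    (step : (X -> R) -> X -> R) (k B : R) (h0 : X -> R) :
  0 <= k < 1 -> (forall x, 0 <= w x) -> good h0 ->
  (forall h, good h -> good (step h)) ->
  (forall h g D, good h -> good g -> 0 <= D ->
     (forall x, Rabs (h x - g x) <= D * w x) ->
     forall x, Rabs (step h x - step g x) <= k * D * w x) ->
  (forall x, Rabs (step h0 x - h0 x) <= B * w x) -> 0 <= B ->
  (forall (u : nat -> X -> R) l C, (forall n, good (u n)) ->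
     (forall n x, Rabs (u n x - l x) <= C * k ^ n * w x) -> good l) ->
  exists h, good h /\ forall x, step h x = h x.
Proof.
intros Hk Hw G0 Gs Hc H0 HB Gl.
set (u := fix u n := match n with O => h0 | S n => step (u n) end).
assert (Gu : forall n, good (u n)) by (induction n; simpl; auto).
assert (Du : forall n x, Rabs (u (S n) x - u n x) <= B * k ^ n * w x).
  induction n as [|n IH]; intros x; [simpl; rewrite Rmult_1_r; apply H0|].
  assert (P : 0 <= B * k ^ n) by (apply Rmult_le_pos; [lra|now apply pow_le]).
  eapply Rle_trans; [apply (Hc (u (S n)) (u n) _ (Gu _) (Gu _) P IH)|].
  simpl; right; ring.
set (l x := real (Lim_seq (fun n => u n x))).
assert (Hl : forall n x, Rabs (u n x - l x) <= B * w x / (1 - k) * k ^ n).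
  intros n x; apply (geometric_tail (fun n => u n x)); auto.
  intros p; eapply Rle_trans; [apply Du|right; ring].
assert (Hl' : forall n x, Rabs (u n x - l x) <= B / (1 - k) * k ^ n * w x).
  intros n x; eapply Rle_trans; [apply Hl|right; field; lra].
assert (GL : good l) by (eapply Gl; eauto).
exists l; split; [exact GL|intros x].
assert (C : 0 <= B / (1 - k)) by (apply Rmult_le_pos; [lra|left; apply Rinv_0_lt_compat; lra]).
assert (E : forall n, Rabs (step l x - l x) <= 2 * (B / (1 - k) * w x) * k ^ n).
  intros n.
  assert (P : 0 <= B / (1 - k) * k ^ n) by (apply Rmult_le_pos; [lra|now apply pow_le]).
  assert (H1 := Hc (u n) l _ (Gu n) GL P (Hl' n) x).
  assert (H2 := Hl' (S n) x); simpl in H2.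
  replace (step l x - l x) with (- (step (u n) x - step l x) + (step (u n) x - l x)) by ring.
  eapply Rle_trans; [apply Rabs_triang|]; rewrite Rabs_Ropp.
  assert (Q : 0 <= B / (1 - k) * k ^ n * w x) by (apply Rmult_le_pos; auto).
  nra.
assert (K : is_lim_seq (fun n => 2 * (B / (1 - k) * w x) * k ^ n) 0).
  replace (Finite 0) with (Rbar_mult (2 * (B / (1 - k) * w x)) 0) by (simpl; f_equal; ring).
  apply is_lim_seq_scal_l, is_lim_seq_geom; rewrite Rabs_pos_eq; lra.
assert (Z := is_lim_seq_le _ _ _ _ E (is_lim_seq_const _) K); simpl in Z.
assert (Z' := Rabs_pos (step l x - l x)).
destruct (Req_dec (step l x - l x) 0) as [|N]; [lra|].
apply Rabs_pos_lt in N; lra.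
Qed.

Lemma is_derive_continuous (f : R -> R) (x l : R) : is_derive f x l -> continuous f x.
Proof. intros H; apply (ex_derive_continuous (V := R_NormedModule)); now exists l. Qed.

Definition prim (h : R -> R) (t : R) : R := RInt h 0 t.

Lemma is_derive_prim (h : R -> R) (t : R) : (forall s, continuous h s) -> is_derive (prim h) t (h t).
Proof.
intros Hh; apply (is_derive_RInt h (prim h) 0); [|apply Hh].
exists (mkposreal 1 Rlt_0_1); intros s _.
apply (RInt_correct h 0 s), (ex_RInt_continuous h); auto.
Qed.

Lemma prim_0 (h : R -> R) : prim h 0 = 0.
Proof. exact (RInt_point 0 h). Qed.

Lemma continuous_prim (h : R -> R) (t : R) : (forall s, continuous h s) -> continuous (prim h) t.
Proof.
intros Hh; apply (is_derive_continuous _ _ (h t)); now apply is_derive_prim.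
Qed.

(** Both [G - F] and [G + F] are nondecreasing. This comparison yields the weighted integral bounds,
    Gronwall's inequality and the constancy of a function with zero derivative. *)
Lemma increment_bound (F G f g : R -> R) (t : R) :
  0 <= t ->
  (forall s, 0 <= s <= t -> is_derive F s (f s)) ->
  (forall s, 0 <= s <= t -> is_derive G s (g s)) ->
  (forall s, 0 <= s <= t -> Rabs (f s) <= g s) ->
  Rabs (F t - F 0) <= G t - G 0.
Proof.
intros Ht HF HG Hfg.
assert (mono : forall H h : R -> R, (forall s, 0 <= s <= t -> is_derive H s (h s)) ->
  (forall s, 0 <= s <= t -> 0 <= h s) -> 0 <= H t - H 0).
  intros H h HH Hh.
  destruct (MVT_gen H 0 t h) as (c & Hc & E);
    rewrite ?Rmin_left, ?Rmax_right in * by lra.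
  - intros x Hx; apply HH; lra.
  - intros x Hx; apply continuity_pt_filterlim.
    eapply is_derive_continuous, HH; lra.
  - rewrite E; apply Rmult_le_pos; [now apply Hh|lra].
assert (P := mono (fun s => G s - F s) (fun s => g s - f s)).
assert (Q := mono (fun s => G s + F s) (fun s => g s + f s)).
simpl in P, Q.
assert (P' : 0 <= G t - F t - (G 0 - F 0)).
  apply P; intros s Hs; [apply (is_derive_minus G F); auto|].
  assert (H := Hfg s Hs); apply Rabs_le_between in H; lra.
assert (Q' : 0 <= G t + F t - (G 0 + F 0)).
  apply Q; intros s Hs; [apply (is_derive_plus G F); auto|].
  assert (H := Hfg s Hs); apply Rabs_le_between in H; lra.
apply Rabs_le; lra.
Qed.

(** Discrepancies are extended continuously beyond [0, 1], so primitives are differentiable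
    everywhere and the end points need no one-sided derivatives. *)
Definition clamp (t : R) : R := Rmax 0 (Rmin 1 t).

Lemma clamp_range t : 0 <= clamp t <= 1.
Proof.
unfold clamp; split; [apply Rmax_l|apply Rmax_lub; [lra|apply Rmin_l]].
Qed.

Lemma clamp_id t : 0 <= t <= 1 -> clamp t = t.
Proof. intros Ht; unfold clamp; rewrite Rmin_right, Rmax_right; lra. Qed.

Lemma continuous_clamp t : continuous clamp t.
Proof.
apply (continuous_ext (fun t => (0 + (1 + t - Rabs (1 - t)) / 2
  + Rabs (0 - (1 + t - Rabs (1 - t)) / 2)) / 2)).
  intros s; unfold clamp, Rmax, Rmin; unfold Rabs.
  repeat (destruct Rle_dec || destruct Rcase_abs); lra.
apply continuity_pt_filterlim; reg.
Qed.

(** Each integration of [exp (4 s)] gains a factor 1/4. The first bound keeps the term -1 because,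
    with [exp 4 <= 81], it then gives exactly 20 D at the end point. *)
Lemma prim_diff_bound (h g : R -> R) (D : R) :
  (forall s, continuous h s) -> (forall s, continuous g s) -> 0 <= D ->
  (forall s, Rabs (h s - g s) <= D * exp (4 * clamp s)) ->
  forall t, 0 <= t <= 1 ->
  Rabs (prim h t - prim g t) <= D * (exp (4 * t) - 1) / 4 /\
  Rabs (prim (prim h) t - prim (prim g) t) <= D * exp (4 * t) / 16.
Proof.
intros Hh Hg HD HB.
assert (P1 : forall t, 0 <= t <= 1 ->
    Rabs (prim h t - prim g t) <= D * (exp (4 * t) - 1) / 4).
  intros t Ht.
  assert (H := increment_bound (fun s => prim h s - prim g s) (fun s => D * exp (4 * s) / 4)
    (fun s => h s - g s) (fun s => D * exp (4 * s)) t (proj1 Ht)).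
  simpl in H; rewrite !prim_0, Rmult_0_r, exp_0 in H.
  replace (prim h t - prim g t) with (prim h t - prim g t - (0 - 0)) by ring.
  replace (D * (exp (4 * t) - 1) / 4) with (D * exp (4 * t) / 4 - D * 1 / 4) by field.
  apply H; intros s Hs.
  - apply (is_derive_minus (prim h) (prim g)); now apply is_derive_prim.
  - auto_derive; auto; field.
  - rewrite <- (clamp_id s) at 3 by lra; apply HB.
intros t Ht; split; [now apply P1|].
assert (H := increment_bound (fun s => prim (prim h) s - prim (prim g) s)
  (fun s => D * exp (4 * s) / 16) (fun s => prim h s - prim g s)
  (fun s => D * exp (4 * s) / 4) t (proj1 Ht)).
simpl in H; rewrite !prim_0, Rmult_0_r, exp_0 in H.
replace (prim (prim h) t - prim (prim g) t)
  with (prim (prim h) t - prim (prim g) t - (0 - 0)) by ring.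
apply Rle_trans with (D * exp (4 * t) / 16 - D * 1 / 16); [|lra].
apply H; intros s Hs.
- apply (is_derive_minus (prim (prim h)) (prim (prim g)));
    apply is_derive_prim; intros; now apply continuous_prim.
- auto_derive; auto; field.
- eapply Rle_trans; [apply P1; lra|lra].
Qed.

Lemma exp_4_le : exp 4 <= 81.
Proof.
replace 4 with (1 + 1 + 1 + 1) by ring; rewrite !exp_plus.
assert (H := exp_le_3); assert (H' := exp_pos 1).
assert (H2 : 0 < exp 1 * exp 1 <= 9) by (split; nra).
replace 81 with (9 * 9) by ring; rewrite Rmult_assoc; nra.
Qed.

Lemma exp_clamp t : 1 <= exp (4 * clamp t) <= 81.
Proof.
assert (H := clamp_range t); split.
  rewrite <- exp_0; destruct (Req_dec (clamp t) 0) as [E|N].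
    rewrite E, Rmult_0_r; lra.
  left; apply exp_increasing; lra.
eapply Rle_trans; [|apply exp_4_le].
destruct (Req_dec (clamp t) 1) as [E|N].
  rewrite E, Rmult_1_r; lra.
left; apply exp_increasing; lra.
Qed.

(** A polynomial with integer coefficients over [Sp] cannot end at a multiple of [PI]; this gap is
    made up by the third parameter in [state]. *)
Definition angle_defect : R := peval p3 1 / IZR Sp - 7 * PI / 18.

Lemma PI_approx : 3.14159265358 < PI < 3.1415926536.
Proof.
(* Consecutive partial sums of the alternating series for [2 atan (1/3) + atan (1/7)] bracket
   [PI / 4]. *)
assert (H := PI_2_3_7_ineq 5); simpl in H.
unfold tg_alt, PI_2_3_7_tg, Ratan_seq in H; simpl in H.
lra.
Qed.

Lemma angle_defect_small : Rabs angle_defect <= 1 / IZR Sv.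
Proof.
unfold angle_defect, Sp, Sv; simpl; assert (H := PI_approx).
apply Rabs_le; lra.
Qed.

(** * The contraction *)

(* [h i] is the discrepancy between the accelerations (for [i = 2], the angular
   velocity) along the sought solution and along the polynomial model. *)
Definition state (h : nat * R -> R) (t : R) : point :=
  let c i s := h (i, s) in
  Point (prim (prim (c 0%nat)) t) (prim (prim (c 1%nat)) t)
        (- prim (c 0%nat) 1) (- prim (c 1%nat) 1) (- (angle_defect + prim (c 2%nat) 1)).

Definition residual (i : nat) : point -> R -> R :=
  match i with O => residual_f | 1%nat => residual_r | _ => residual_th end.

Definition step (h : nat * R -> R) (p : nat * R) : R :=
  residual (fst p) (state h (clamp (snd p))) (2 * clamp (snd p) - 1).

(** The angular rate is certified with half the slope bound, so its discrepancy may be kept half as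
    large, which halves the allowed size of [a3]. *)
Definition comp_weight (i : nat) : R := match i with O | 1%nat => 1 | _ => 1 / 2 end.

Definition weight (p : nat * R) : R := comp_weight (fst p) * exp (4 * clamp (snd p)).

Definition admissible (h : nat * R -> R) : Prop :=
  (forall i t, continuous (fun s => h (i, s)) t) /\
  forall p, Rabs (h p) <= 5 / IZR Sv * weight p.

Lemma comp_weight_range i : 1 / 2 <= comp_weight i <= 1.
Proof. destruct i as [|[|]]; simpl; lra. Qed.

Lemma weight_range p : 0 < weight p <= 81.
Proof.
unfold weight; assert (H := exp_clamp (snd p)).
assert (H1 := comp_weight_range (fst p)); nra.
Qed.

Lemma Sv_pos : 0 < IZR Sv.
Proof. now apply IZR_lt. Qed.

Lemma state_diff h g D :
  (forall i t, continuous (fun s => h (i, s)) t) ->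
  (forall i t, continuous (fun s => g (i, s)) t) -> 0 <= D ->
  (forall p, Rabs (h p - g p) <= D * weight p) ->
  forall t, 0 <= t <= 1 ->
  Rabs (e1 (state h t) - e1 (state g t)) <= D * exp (4 * t) / 16 /\
  Rabs (e2 (state h t) - e2 (state g t)) <= D * exp (4 * t) / 16 /\
  Rabs (a1 (state h t) - a1 (state g t)) <= 20 * D /\
  Rabs (a2 (state h t) - a2 (state g t)) <= 20 * D /\
  Rabs (a3 (state h t) - a3 (state g t)) <= 10 * D.
Proof.
intros Hh Hg HD HB t Ht.
assert (P : forall i, let c := comp_weight i in
  Rabs (prim (fun s => h (i, s)) 1 - prim (fun s => g (i, s)) 1) <= D * c * 20 /\
  Rabs (prim (prim (fun s => h (i, s))) t - prim (prim (fun s => g (i, s))) t)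
    <= D * c * exp (4 * t) / 16).
  intros i c.
  assert (Hc : 0 <= D * c).
    assert (H := comp_weight_range i); unfold c; nra.
  assert (B : forall s, Rabs (h (i, s) - g (i, s)) <= D * c * exp (4 * clamp s)).
    intros s; rewrite Rmult_assoc; exact (HB (i, s)).
  assert (Q := prim_diff_bound (fun s => h (i, s)) (fun s => g (i, s)) (D * c) (Hh i) (Hg i) Hc B).
  split; [|apply Q, Ht].
  destruct (Q 1) as [Q1 _]; [lra|].
  replace (4 * 1) with 4 in Q1 by ring.
  (* [(81 - 1) / 4 = 20]; for the angle, the component weight 1/2 turns this into 10. *)
  assert (E := Rmult_le_compat_l _ _ _ Hc exp_4_le); lra.
assert (P0 := P 0%nat); assert (P1 := P 1%nat); assert (P2 := P 2%nat); simpl in P0, P1, P2.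
assert (N : forall a b, - a - - b = - (a - b)) by (intros; ring).
simpl; rewrite !N, !Rabs_Ropp.
replace (angle_defect + prim (fun s => h (2%nat, s)) 1 - (angle_defect + prim (fun s => g (2%nat, s)) 1))
  with (prim (fun s => h (2%nat, s)) 1 - prim (fun s => g (2%nat, s)) 1) by ring.
repeat split; lra.
Qed.

Lemma prim_zero t : prim (fun _ => 0) t = 0.
Proof.
unfold prim; rewrite RInt_const; unfold scal; simpl; unfold mult; simpl; ring.
Qed.

Lemma state_zero t : state (fun _ => 0) t = Point 0 0 0 0 (- angle_defect).
Proof.
assert (Z : forall s, prim (prim (fun _ => 0)) s = 0).
  intros s; rewrite <- (prim_zero s) at 1; apply RInt_ext; intros; apply prim_zero.
unfold state; cbv zeta beta; rewrite !Z, !prim_zero, Rplus_0_r, Ropp_0; reflexivity.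
Qed.

Lemma admissible_zero : admissible (fun _ => 0).
Proof.
split; [intros; apply continuous_const|intros p].
rewrite Rabs_R0; apply Rmult_le_pos; [|left; apply weight_range].
assert (H := Sv_pos); apply Rmult_le_pos; [lra|left; now apply Rinv_0_lt_compat].
Qed.

(** The zero discrepancy has the state [origin] except for [a3 = - angle_defect], of size at most
    [1 / Sv]. The radius is enlarged from 5 to 51/10 so that 10 D covers [50 / Sv] plus this
    defect. *)
Lemma state_bound h t : admissible h -> 0 <= t <= 1 ->
  let D := 51 / 10 / IZR Sv in
  Rabs (e1 (state h t)) <= D * exp (4 * t) / 16 /\
  Rabs (e2 (state h t)) <= D * exp (4 * t) / 16 /\
  Rabs (a1 (state h t)) <= 20 * D /\ Rabs (a2 (state h t)) <= 20 * D /\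
  Rabs (a3 (state h t)) <= 10 * D.
Proof.
intros [Hc Hb] Ht D.
destruct (state_diff h (fun _ => 0) (5 / IZR Sv)) with (t := t) as (H1 & H2 & H3 & H4 & H5);
  try assumption.
- intros; apply continuous_const.
- assert (H := Sv_pos); apply Rmult_le_pos; [lra|left; now apply Rinv_0_lt_compat].
- intros p; rewrite Rminus_0_r; apply Hb.
- rewrite state_zero in *; cbn [e1 e2 a1 a2 a3] in *.
  rewrite Rminus_0_r in *.
  assert (A := angle_defect_small).
  assert (HS := Rinv_0_lt_compat _ Sv_pos); unfold D, Rdiv in *.
  assert (He := exp_pos (4 * t)).
  assert (0 <= / IZR Sv * exp (4 * t)) by nra.
  replace (a3 (state h t)) with (a3 (state h t) - - angle_defect + - angle_defect) by ring.
  repeat split; try lra.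
  eapply Rle_trans; [apply Rabs_triang|rewrite (Rabs_Ropp angle_defect); lra].
Qed.

Lemma state_in_box h t : admissible h -> 0 <= t <= 1 -> in_box (state h t).
Proof.
intros Hh Ht.
destruct (state_bound h t Hh Ht) as (H1 & H2 & H3 & H4 & H5).
assert (HE := exp_clamp t); rewrite clamp_id in HE by exact Ht.
assert (HS := Sv_pos).
assert (T : forall u k b, Rabs u <= k * (51 / 10 / IZR Sv) -> k * (51 / 10) <= b ->
  Rabs u * IZR Sv <= b).
  intros u k b Hu Hb.
  apply Rle_trans with (k * (51 / 10 / IZR Sv) * IZR Sv);
    [apply Rmult_le_compat_r; lra|].
  replace (k * (51 / 10 / IZR Sv) * IZR Sv) with (k * (51 / 10)) by (field; lra); exact Hb.
repeat split.
(* [81 / 16 * 5.1 < 26], and likewise 20 and 10 times 5.1 stay below 104 and 52: this is how the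
   radii of the box are chosen. *)
- apply (T _ (exp (4 * t) / 16)); lra.
- apply (T _ (exp (4 * t) / 16)); lra.
- apply (T _ 20); lra.
- apply (T _ 20); lra.
- apply (T _ 10); lra.
Qed.

Lemma unit_clamp t : Rabs (2 * clamp t - 1) <= 1.
Proof. assert (H := clamp_range t); apply Rabs_le; lra. Qed.

Lemma step_contracts h g D : admissible h -> admissible g -> 0 <= D ->
  (forall p, Rabs (h p - g p) <= D * weight p) ->
  forall p, Rabs (step h p - step g p) <= 3 / 4 * D * weight p.
Proof.
intros Hh Hg HD HB [i t].
assert (Ht := clamp_range t).
destruct (state_diff h g D (proj1 Hh) (proj1 Hg) HD HB (clamp t) Ht)
  as (H1 & H2 & H3 & H4 & H5).
destruct (residual_lipschitz (state h (clamp t)) (state g (clamp t)) (2 * clamp t - 1) D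
  (exp (4 * clamp t))) as (K1 & K2 & K3);
  auto using unit_clamp, state_in_box; [apply exp_clamp|].
unfold step, weight; simpl; destruct i as [|[|i]]; simpl; lra.
Qed.

(** The comparison is with [origin], where the defect is certified: in units of [1 / Sv],
    [3/4 * 5.1 + 5/8 = 4.45] is less than 5, so the ball is mapped into itself. *)
Lemma step_bounded h : admissible h ->
  forall p, Rabs (step h p) <= 5 / IZR Sv * weight p.
Proof.
intros Hh [i t].
assert (Ht := clamp_range t).
assert (HS := Rinv_0_lt_compat _ Sv_pos).
set (D := 51 / 10 / IZR Sv).
destruct (state_bound h (clamp t) Hh Ht) as (H1 & H2 & H3 & H4 & H5).
assert (HE := exp_clamp t).
destruct (residual_lipschitz (state h (clamp t)) origin (2 * clamp t - 1) D
  (exp (4 * clamp t))) as (K1 & K2 & K3);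
  simpl; rewrite ?Rminus_0_r; auto using unit_clamp, state_in_box.
- unfold in_box; simpl; rewrite Rabs_R0, Rmult_0_l; lra.
- unfold D, Rdiv; lra.
- lra.
- destruct (residual_origin (2 * clamp t - 1) (unit_clamp t)) as (O1 & O2 & O3).
  assert (F : / IZR Sv <= / IZR Sv * exp (4 * clamp t)) by nra.
  unfold step, weight, D, Rdiv in *; simpl; destruct i as [|[|i]]; simpl.
  + replace (residual_f _ _) with (residual_f (state h (clamp t)) (2 * clamp t - 1)
      - residual_f origin (2 * clamp t - 1) + residual_f origin (2 * clamp t - 1)) by ring.
    eapply Rle_trans; [apply Rabs_triang|lra].
  + replace (residual_r _ _) with (residual_r (state h (clamp t)) (2 * clamp t - 1)
      - residual_r origin (2 * clamp t - 1) + residual_r origin (2 * clamp t - 1)) by ring.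
    eapply Rle_trans; [apply Rabs_triang|lra].
  + replace (residual_th _ _) with (residual_th (state h (clamp t)) (2 * clamp t - 1)
      - residual_th origin (2 * clamp t - 1) + residual_th origin (2 * clamp t - 1)) by ring.
    eapply Rle_trans; [apply Rabs_triang|lra].
Qed.

(** * The quarter period *)

Lemma cont_plus (f g : R -> R) (x : R) :
  continuous f x -> continuous g x -> continuous (fun t => f t + g t) x.
Proof. exact (continuous_plus f g x). Qed.

Lemma cont_mult (f g : R -> R) (x : R) :
  continuous f x -> continuous g x -> continuous (fun t => f t * g t) x.
Proof. exact (continuous_mult f g x). Qed.

Lemma cont_opp (f : R -> R) (x : R) : continuous f x -> continuous (fun t => - f t) x.
Proof. exact (continuous_opp f x). Qed.

Lemma cont_pow (f : R -> R) (n : nat) (x : R) :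
  continuous f x -> continuous (fun t => f t ^ n) x.
Proof.
intros Hf; induction n as [|n IH]; simpl; [apply continuous_const|now apply cont_mult].
Qed.

Lemma cont_div (f g : R -> R) (x : R) :
  continuous f x -> continuous g x -> g x <> 0 -> continuous (fun t => f t / g t) x.
Proof. intros; apply cont_mult; [|apply continuous_Rinv_comp]; assumption. Qed.

Lemma cont_peval l (f : R -> R) (x : R) :
  continuous f x -> continuous (fun t => peval l (f t)) x.
Proof.
intros Hf; apply (continuous_comp f (peval l)); [exact Hf|].
eapply is_derive_continuous, is_derive_peval.
Qed.

Ltac cont :=
  lazymatch goal with
  | |- continuous (fun _ => ?c) _ => apply continuous_const
  | |- continuous (fun t => @?f t + @?g t) ?x => apply (cont_plus f g x); cont
  | |- continuous (fun t => @?f t * @?g t) ?x => apply (cont_mult f g x); cont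
  | |- continuous (fun t => @?f t / @?g t) ?x => apply (cont_div f g x); cont
  | |- continuous (fun t => - @?f t) ?x => apply (cont_opp f x); cont
  | |- continuous (fun t => @?f t - @?g t) ?x =>
      apply (cont_plus f (fun t => - g t) x); cont
  | |- continuous (fun t => @?f t ^ ?n) ?x => apply (cont_pow f n x); cont
  | |- continuous (fun t => peval ?l (@?f t)) ?x => apply (cont_peval l f x); cont
  | |- continuous (fun t => sqrt (@?f t)) ?x => apply (continuous_sqrt_comp f x); cont
  | |- _ => try assumption
  end.

Lemma continuous_step h i (t : R) : admissible h -> continuous (fun s : R => step h (i, s)) t.
Proof.
intros Hh.
assert (Hc := continuous_clamp t).
change (continuous (fun s => clamp s) t) in Hc.
assert (Hx : continuous (fun s => 2 * clamp s - 1) t) by cont.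
assert (HE : forall j, continuous (fun s => prim (prim (fun s => h (j, s))) (clamp s)) t).
  intros j; apply (continuous_comp clamp); [exact Hc|].
  apply continuous_prim; intros; apply continuous_prim, Hh.
assert (R0 : 0 < pos_r (state h (clamp t)) (2 * clamp t - 1)).
  apply pos_r_positive; [apply unit_clamp|apply state_in_box; [exact Hh|apply clamp_range]].
assert (D0 := sep_pos (pos_f (state h (clamp t)) (2 * clamp t - 1)) _ R0).
assert (HC : forall p w1 w2 w3,
    continuous (fun s => curve p w1 w2 w3 (state h (clamp s)) (2 * clamp s - 1)) t).
  intros; unfold curve; cbn [state a1 a2 a3]; cont; apply Rgt_not_eq; now apply IZR_lt.
assert (Hf : continuous (fun s => pos_f (state h (clamp s)) (2 * clamp s - 1)) t).
  apply cont_plus; [apply HC|exact (HE 0%nat)].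
assert (Hr : continuous (fun s => pos_r (state h (clamp s)) (2 * clamp s - 1)) t).
  apply cont_plus; [apply HC|exact (HE 1%nat)].
(* The parameters in [state h t] do not depend on [t], so this function is convertible to a constant
   one. *)
assert (Hq : continuous (fun s => par_q (state h (clamp s))) t)
  by exact (continuous_const (par_q (state h 0)) t).
assert (Hm : continuous (fun s => par_m (state h (clamp s))) t)
  by exact (continuous_const (par_m (state h 0)) t).
assert (HD : continuous (fun s => sep (pos_f (state h (clamp s)) (2 * clamp s - 1))
    (pos_r (state h (clamp s)) (2 * clamp s - 1))) t).
  unfold sep; cont.
unfold step; cbn [fst snd].
destruct i as [|[|i]]; cbn [residual];
  [unfold residual_f, acc_f|unfold residual_r, acc_r|unfold residual_th, rate_th];
  cont; try apply HC; apply Rgt_not_eq, pow_lt; assumption.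
Qed.

(** As the weight is at most 81, weighted convergence is uniform, which preserves continuity; the
    bound passes to the limit pointwise. *)
Lemma admissible_closed (k : R) (u : nat -> nat * R -> R) l C : 0 <= k < 1 ->
  (forall n, admissible (u n)) ->
  (forall n p, Rabs (u n p - l p) <= C * k ^ n * weight p) -> admissible l.
Proof.
intros Hk Hu Hl.
assert (HC : 0 <= C).
  assert (H := Hl 0%nat (0%nat, 0)); simpl in H; rewrite Rmult_1_r in H.
  assert (W := weight_range (0%nat, 0)).
  assert (H' := Rabs_pos (u 0%nat (0%nat, 0) - l (0%nat, 0))); nra.
assert (K : forall c, 0 <= c -> is_lim_seq (fun n => c * k ^ n) 0).
  intros c Hc; replace (Finite 0) with (Rbar_mult c 0) by (simpl; f_equal; ring).
  apply is_lim_seq_scal_l, is_lim_seq_geom; rewrite Rabs_pos_eq; lra.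
split.
- intros i t; apply continuity_pt_filterlim.
  apply (CVU_continuity (fun n s => u n (i, s)) _ t (mkposreal 1 Rlt_0_1)).
  + intros eps Heps.
    assert (K' := K (C * 81) ltac:(lra)).
    apply is_lim_seq_spec in K'; destruct (K' (mkposreal eps Heps)) as [N HN].
    exists N; intros n y Hn _.
    specialize (HN n Hn); rewrite Rminus_0_r in HN; simpl in HN; apply Rabs_def2 in HN.
    rewrite Rabs_minus_sym.
    eapply Rle_lt_trans; [apply Hl|].
    assert (W := weight_range (i, y)).
    assert (P : 0 <= C * k ^ n) by (apply Rmult_le_pos; [lra|now apply pow_le]).
    assert (Q := Rmult_le_compat_l _ _ _ P (proj2 W)).
    eapply Rle_lt_trans; [exact Q|].
    replace (C * k ^ n * 81) with (C * 81 * k ^ n) by ring; apply HN.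
  + intros n y _; apply continuity_pt_filterlim, Hu.
  + unfold Boule; simpl; rewrite Rminus_diag, Rabs_R0; lra.
- intros p.
  assert (W := weight_range p).
  assert (K' := K (C * weight p) ltac:(nra)).
  assert (L := is_lim_seq_plus' _ _ _ _ (is_lim_seq_const (5 / IZR Sv * weight p)) K').
  rewrite Rplus_0_r in L.
  refine (is_lim_seq_le _ _ (Rabs (l p)) (5 / IZR Sv * weight p) _ (is_lim_seq_const _) L).
  intros n; simpl.
  replace (l p) with (u n p + - (u n p - l p)) by ring.
  eapply Rle_trans; [apply Rabs_triang|rewrite Rabs_Ropp].
  apply Rplus_le_compat; [apply Hu|].
  eapply Rle_trans; [apply Hl|right; ring].
Qed.

Lemma exists_fixed_discrepancy : exists h, admissible h /\ forall p, step h p = h p.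
Proof.
apply (weighted_fixed_point weight admissible step (3 / 4) (5 / IZR Sv) (fun _ => 0)).
- lra.
- intros p; left; apply weight_range.
- apply admissible_zero.
- intros h Hh; split; [intros; now apply continuous_step|now apply step_bounded].
- apply step_contracts.
- intros p; rewrite Rminus_0_r; apply step_bounded, admissible_zero.
- apply Rmult_le_pos; [lra|left; apply Rinv_0_lt_compat, Sv_pos].
- intros u l C; apply admissible_closed; lra.
Qed.

(* The parameter [c] is [b T / 10]. *)
Record quarter (c q m : R) (f df r dr th : R -> R) : Prop := {
  quarter_df : forall t, is_derive f t (df t);
  quarter_dr : forall t, is_derive r t (dr t);
  quarter_f2 : forall t, 0 <= t <= 1 -> is_derive df t (acc_f q (f t) (r t));
  quarter_r2 : forall t, 0 <= t <= 1 -> is_derive dr t (acc_r q m (f t) (r t));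
  quarter_dth : forall t, 0 <= t <= 1 -> is_derive th t (rate_th m (r t));
  quarter_r_pos : forall t, 0 <= t <= 1 -> 0 < r t;
  quarter_f0 : f 0 = 0; quarter_df0 : df 0 = c;
  quarter_r0 : r 0 = 1; quarter_dr0 : dr 0 = 0; quarter_th0 : th 0 = 0;
  quarter_df1 : df 1 = 0; quarter_dr1 : dr 1 = 0; quarter_th1 : th 1 = 7 * PI / 18
}.

(** The initial velocity of [f]: [x = -1] is [tau = 0] and 2 is [dx/dtau]. The remainder contributes
    nothing, its derivative being a primitive that vanishes at 0. *)
Definition par_c (z : point) : R :=
  2 * curve (pderiv p1) (pderiv v11) (pderiv v12) (pderiv v13) z (-1).

Lemma is_derive_curve p w1 w2 w3 z t :
  is_derive (fun t => curve p w1 w2 w3 z (2 * t - 1)) t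
    (2 * curve (pderiv p) (pderiv w1) (pderiv w2) (pderiv w3) z (2 * t - 1)).
Proof.
assert (D : forall l s, Derive (fun y : R => peval l y) s = peval (pderiv l) s)
  by (intros; apply is_derive_unique, is_derive_peval).
assert (HS := Sv_pos).
assert (HS' : 0 < IZR Sp) by now apply IZR_lt.
unfold curve; auto_derive.
  repeat split; eexists; apply is_derive_peval.
rewrite !D; unfold Rminus; field; lra.
Qed.

(** Moves the evaluation at [x = 1] or [x = -1] into the integers, where it computes; the adjusted
    coefficients then make the boundary conditions exact identities. *)
Lemma curve_end p w1 w2 w3 z (s : Z) :
  curve p w1 w2 w3 z (IZR s) =
  IZR (fold_right (fun a b => a + s * b)%Z 0%Z p) / IZR Sp +
  (IZR (fold_right (fun a b => a + s * b)%Z 0%Z w1) * a1 z +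
   IZR (fold_right (fun a b => a + s * b)%Z 0%Z w2) * a2 z +
   IZR (fold_right (fun a b => a + s * b)%Z 0%Z w3) * a3 z) / IZR Sv.
Proof.
assert (E : forall l, peval l (IZR s) = IZR (fold_right (fun a b => a + s * b)%Z 0%Z l)).
  induction l as [|a l IH]; simpl; [reflexivity|].
  rewrite plus_IZR, mult_IZR, IH; reflexivity.
unfold curve; now rewrite !E.
Qed.

(** At the fixed point the discrepancy equals the residual along its own state, so model
    acceleration plus [h] is the true acceleration. The terminal conditions hold because each
    parameter was chosen to cancel the corresponding integral of [h] at time 1. *)
Lemma exists_quarter : exists z f df r dr th,
  in_box z /\ quarter (par_c z) (par_q z) (par_m z) f df r dr th.
Proof.
destruct exists_fixed_discrepancy as (h & Hh & E).
set (z := state h).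
set (y t := 2 * t - 1).
assert (Hc : forall i t, continuous (fun s => h (i, s)) t) by apply Hh.
assert (HS : IZR Sv <> 0) by (apply Rgt_not_eq, Sv_pos).
assert (HS' : IZR Sp <> 0) by (apply Rgt_not_eq; now apply IZR_lt).
assert (Cz : forall p w1 w2 w3 t x, curve p w1 w2 w3 (z t) x = curve p w1 w2 w3 (z 0) x)
  by reflexivity.
exists (z 0), (fun t => pos_f (z t) (y t)),
  (fun t => 2 * curve (pderiv p1) (pderiv v11) (pderiv v12) (pderiv v13) (z 0) (y t)
            + prim (fun s => h (0%nat, s)) t),
  (fun t => pos_r (z t) (y t)),
  (fun t => 2 * curve (pderiv p2) (pderiv v21) (pderiv v22) (pderiv v23) (z 0) (y t)
            + prim (fun s => h (1%nat, s)) t),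
  (fun t => curve p3 v31 v32 v33 (z 0) (y t) + prim (fun s => h (2%nat, s)) t).
split; [apply state_in_box; [exact Hh|lra]|].
assert (Ex : forall i t, 0 <= t <= 1 -> h (i, t) = residual i (z t) (y t)).
  intros i t Ht; rewrite <- E; unfold step; cbn [fst snd]; now rewrite clamp_id.
assert (Y1 : y 1 = IZR 1) by (unfold y; lra).
assert (Y0 : y 0 = IZR (-1)) by (unfold y; lra).
constructor.
- intros t; unfold pos_f; apply (is_derive_plus (V := R_NormedModule)
    (fun t => curve p1 v11 v12 v13 (z 0) (y t)) (fun t => e1 (z t))).
    apply is_derive_curve.
  apply is_derive_prim; intros; now apply continuous_prim.
- intros t; unfold pos_r; apply (is_derive_plus (V := R_NormedModule)
    (fun t => curve p2 v21 v22 v23 (z 0) (y t)) (fun t => e2 (z t))).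
    apply is_derive_curve.
  apply is_derive_prim; intros; now apply continuous_prim.
- intros t Ht.
  replace (acc_f _ _ _) with (2 * (2 * curve (pderiv2 p1) (pderiv2 v11) (pderiv2 v12)
    (pderiv2 v13) (z 0) (y t)) + h (0%nat, t))
    by (rewrite Ex by exact Ht; cbn [residual]; unfold residual_f;
        rewrite (Cz _ _ _ _ t); change (par_q (z t)) with (par_q (z 0)); ring).
  apply (is_derive_plus (V := R_NormedModule) (fun t => 2 * curve _ _ _ _ (z 0) (y t))
    (prim (fun s => h (0%nat, s)))); [|apply (is_derive_prim (fun s => h (0%nat, s))); auto].
  apply (is_derive_scal (fun t => curve _ _ _ _ (z 0) (y t))), is_derive_curve.
- intros t Ht.
  replace (acc_r _ _ _ _) with (2 * (2 * curve (pderiv2 p2) (pderiv2 v21) (pderiv2 v22)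
    (pderiv2 v23) (z 0) (y t)) + h (1%nat, t))
    by (rewrite Ex by exact Ht; cbn [residual]; unfold residual_r;
        rewrite (Cz _ _ _ _ t); change (par_q (z t)) with (par_q (z 0));
        change (par_m (z t)) with (par_m (z 0)); ring).
  apply (is_derive_plus (V := R_NormedModule) (fun t => 2 * curve _ _ _ _ (z 0) (y t))
    (prim (fun s => h (1%nat, s)))); [|apply (is_derive_prim (fun s => h (1%nat, s))); auto].
  apply (is_derive_scal (fun t => curve _ _ _ _ (z 0) (y t))), is_derive_curve.
- intros t Ht.
  replace (rate_th _ _) with (2 * curve (pderiv p3) (pderiv v31) (pderiv v32)
    (pderiv v33) (z 0) (y t) + h (2%nat, t))
    by (rewrite Ex by exact Ht; cbn [residual]; unfold residual_th;
        rewrite (Cz _ _ _ _ t); change (par_m (z t)) with (par_m (z 0)); ring).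
  apply (is_derive_plus (V := R_NormedModule) (fun t => curve _ _ _ _ (z 0) (y t))
    (prim (fun s => h (2%nat, s)))); [|apply (is_derive_prim (fun s => h (2%nat, s))); auto].
  apply is_derive_curve.
- intros t Ht; apply pos_r_positive; [|now apply state_in_box].
  unfold y; apply Rabs_le; lra.
- unfold pos_f; rewrite Y0, curve_end; simpl; rewrite prim_0; field; auto.
- rewrite prim_0, Y0; unfold par_c; ring.
- unfold pos_r; rewrite Y0, curve_end; simpl; rewrite prim_0; unfold Sp; field; auto.
- rewrite Y0, curve_end; simpl; rewrite prim_0; field; auto.
- rewrite Y0, curve_end; simpl; rewrite prim_0; field; auto.
- rewrite Y1, curve_end; simpl; unfold Sv; field; auto.
- rewrite Y1, curve_end; simpl; unfold Sv; field; auto.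
(* Here the end value of the model is kept symbolic; the defect in it cancels against the one in
   [a3], leaving the exact angle. *)
- assert (A : peval p3 1 / IZR Sp = angle_defect + 7 * PI / 18) by (unfold angle_defect; ring).
  rewrite Y1; unfold curve; rewrite A.
  change 1 with (IZR 1) at 1 2 3; simpl; unfold Sv; field; auto.
Qed.

(** * Extension by reflections *)

Definition floor (x : R) : Z := Int_part x.

Lemma floor_spec x : IZR (floor x) <= x < IZR (floor x) + 1.
Proof. unfold floor; destruct (base_Int_part x); lra. Qed.

Lemma floor_unique x j : IZR j <= x < IZR j + 1 -> floor x = j.
Proof.
intros Hj; assert (H := floor_spec x).
assert (IZR (floor x) < IZR (j + 1)) by (rewrite plus_IZR; lra).
assert (IZR j < IZR (floor x + 1)) by (rewrite plus_IZR; lra).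
apply lt_IZR in H0; apply lt_IZR in H1; lia.
Qed.

Lemma floor_add x j : floor (x + IZR j) = (floor x + j)%Z.
Proof.
apply floor_unique; rewrite plus_IZR; assert (H := floor_spec x); lra.
Qed.

Lemma is_derive_glue (G G' : Z -> R -> R) :
  (forall j x, IZR j <= x <= IZR j + 1 -> is_derive (G j) x (G' j x)) ->
  (forall j, G j (IZR j + 1) = G (j + 1)%Z (IZR j + 1)) ->
  (forall j, G' j (IZR j + 1) = G' (j + 1)%Z (IZR j + 1)) ->
  forall x, is_derive (fun y => G (floor y) y) x (G' (floor x) x).
Proof.
intros HG HV HD x.
set (j := floor x).
assert (Hx := floor_spec x); fold j in Hx.
apply is_derive_Reals; intros eps Heps.
assert (Dj := HG j x ltac:(lra)); apply is_derive_Reals in Dj.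
destruct (Dj eps Heps) as [d Hd].
destruct (Req_dec x (IZR j)) as [E|N].
(* At a node, cell [j] supplies the difference quotients for [0 <= h] and cell [j - 1] those for
   [h < 0]; the matching conditions give both the same value and limit. *)
- assert (Ej : IZR (j - 1) + 1 = x) by (rewrite minus_IZR; lra).
  assert (Dk := HG (j - 1)%Z x ltac:(lra)); apply is_derive_Reals in Dk.
  destruct (Dk eps Heps) as [e He].
  assert (V := HV (j - 1)%Z); assert (D := HD (j - 1)%Z).
  rewrite Ej in V, D; replace (j - 1 + 1)%Z with j in V, D by lia.
  assert (P : 0 < Rmin 1 (Rmin d e)).
    apply Rmin_glb_lt; [lra|apply Rmin_glb_lt; [apply d|apply e]].
  exists (mkposreal _ P); intros h h0 Hh; simpl in Hh.
  assert (H1 := Rmin_l 1 (Rmin d e)); assert (H2 := Rmin_r 1 (Rmin d e)).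
  assert (H3 := Rmin_l d e); assert (H4 := Rmin_r d e).
  fold j; destruct (Rle_dec 0 h) as [p|p].
  + rewrite (floor_unique (x + h) j).
      apply Hd; [exact h0|lra].
    apply Rabs_def2 in Hh; lra.
  + rewrite (floor_unique (x + h) (j - 1)).
      rewrite <- V, <- D; apply He; [exact h0|lra].
    apply Rabs_def2 in Hh; lra.
- assert (P : 0 < Rmin d (Rmin (x - IZR j) (IZR j + 1 - x))).
    apply Rmin_glb_lt; [apply d|apply Rmin_glb_lt; lra].
  exists (mkposreal _ P); intros h h0 Hh; simpl in Hh.
  assert (H1 := Rmin_l d (Rmin (x - IZR j) (IZR j + 1 - x))).
  assert (H2 := Rmin_r d (Rmin (x - IZR j) (IZR j + 1 - x))).
  assert (H3 := Rmin_l (x - IZR j) (IZR j + 1 - x)).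
  assert (H4 := Rmin_r (x - IZR j) (IZR j + 1 - x)).
  fold j; rewrite (floor_unique (x + h) j).
    apply Hd; [exact h0|lra].
  apply Rabs_def2 in Hh; lra.
Qed.

(* The unit cells [j, j + 1] alternate between copies of the quarter period run
   forwards and backwards; [orient] is the direction and [sgn] the sign of [f]. *)
Definition orient (j : Z) : R := if Z.even j then 1 else -1.

Definition sgn (j : Z) : R := if Z.even (j / 2) then 1 else -1.

(** The even end of the cell, where the copy of the quarter motion has its time 0. *)
Definition start (j : Z) : Z := if Z.even j then j else (j + 1)%Z.

Definition local (j : Z) (x : R) : R := orient j * (x - IZR (start j)).

Lemma cell_cases j :
  (orient j = 1 /\ orient (j + 1) = -1 /\ sgn (j + 1) = sgn j /\
   start j = j /\ start (j + 1) = (j + 2)%Z) \/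
  (orient j = -1 /\ orient (j + 1) = 1 /\ sgn (j + 1) = - sgn j /\
   start j = (j + 1)%Z /\ start (j + 1) = (j + 1)%Z).
Proof.
unfold orient, sgn, start; destruct (Z.Even_or_Odd j) as [[k ->]|[k ->]].
- left.
  assert (E1 : Z.even (2 * k) = true) by (rewrite Z.even_mul; reflexivity).
  assert (E2 : Z.even (2 * k + 1) = false) by (rewrite Z.even_add, E1; reflexivity).
  rewrite E1, E2.
  replace ((2 * k + 1) / 2)%Z with (2 * k / 2)%Z
    by (Z.div_mod_to_equations; lia).
  repeat split; lia.
- right.
  assert (E1 : Z.even (2 * k + 1) = false)
    by (rewrite Z.even_add, Z.even_mul; reflexivity).
  assert (E2 : Z.even (2 * k + 1 + 1) = true)
    by (rewrite Z.even_add, E1; reflexivity).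
  rewrite E1, E2.
  replace ((2 * k + 1 + 1) / 2)%Z with ((2 * k + 1) / 2 + 1)%Z
    by (Z.div_mod_to_equations; lia).
  rewrite Z.even_add; destruct (Z.even ((2 * k + 1) / 2)); simpl; repeat split; lra.
Qed.

Lemma orient_sq j : orient j * orient j = 1.
Proof. unfold orient; destruct (Z.even j); ring. Qed.

Lemma sgn_sq j : sgn j * sgn j = 1.
Proof. unfold sgn; destruct (Z.even _); ring. Qed.

Lemma local_range j x : IZR j <= x <= IZR j + 1 -> 0 <= local j x <= 1.
Proof.
intros Hx; unfold local.
destruct (cell_cases j) as [(E1 & _ & _ & E2 & _)|(E1 & _ & _ & E2 & _)];
  rewrite E1, E2; rewrite ?plus_IZR; lra.
Qed.

Lemma is_derive_local (g : R -> R) (l c : R) j x :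
  is_derive g (local j x) l ->
  is_derive (fun y => c * g (local j y)) x (c * orient j * l).
Proof.
intros Hg.
replace (c * orient j * l) with (c * (orient j * l)) by ring.
apply (is_derive_scal (fun y => g (local j y))).
apply (is_derive_comp g (local j)); [exact Hg|].
unfold local; auto_derive; auto; ring.
Qed.

Lemma acc_f_odd q s f r : s * s = 1 -> acc_f q (s * f) r = s * acc_f q f r.
Proof.
intros Hs; unfold acc_f, sep.
replace (r ^ 2 + 4 * (s * f) ^ 2) with (r ^ 2 + 4 * f ^ 2)
  by (replace ((s * f) ^ 2) with (s * s * f ^ 2) by ring; rewrite Hs; ring).
unfold Rdiv; ring.
Qed.

Lemma acc_r_even q m s f r : s * s = 1 -> acc_r q m (s * f) r = acc_r q m f r.
Proof.
intros Hs; unfold acc_r, sep.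
replace (r ^ 2 + 4 * (s * f) ^ 2) with (r ^ 2 + 4 * f ^ 2)
  by (replace ((s * f) ^ 2) with (s * s * f ^ 2) by ring; rewrite Hs; ring).
reflexivity.
Qed.

Record global (c q m : R) (f df r dr th : R -> R) : Prop := {
  global_df : forall t, is_derive f t (df t);
  global_dr : forall t, is_derive r t (dr t);
  global_f2 : forall t, is_derive df t (acc_f q (f t) (r t));
  global_r2 : forall t, is_derive dr t (acc_r q m (f t) (r t));
  global_dth : forall t, is_derive th t (rate_th m (r t));
  global_r_pos : forall t, 0 < r t;
  global_f0 : f 0 = 0; global_df0 : df 0 = c;
  global_r0 : r 0 = 1; global_dr0 : dr 0 = 0; global_th0 : th 0 = 0;
  global_th1 : th 1 = 7 * PI / 18;
  global_f_period : forall t, f (t + 36) = f t;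
  global_r_period : forall t, r (t + 36) = r t;
  global_th_period : forall t, th (t + 36) = th t + 14 * PI
}.

(** Reversing time preserves second derivatives, and the accelerations are odd and even under
    [f -> - f], so every cell carries a solution. At odd nodes both velocities vanish; at even nodes
    [f] and the velocity of [r] vanish while [f] changes sign, so values and first derivatives
    match. *)
Lemma quarter_extends c q m f df r dr th : quarter c q m f df r dr th ->
  exists F dF Rr dR Th, global c q m F dF Rr dR Th.
Proof.
intros Q.
assert (f0 := quarter_f0 _ _ _ _ _ _ _ _ Q); assert (df0 := quarter_df0 _ _ _ _ _ _ _ _ Q).
assert (r0 := quarter_r0 _ _ _ _ _ _ _ _ Q); assert (dr0 := quarter_dr0 _ _ _ _ _ _ _ _ Q).
assert (th0 := quarter_th0 _ _ _ _ _ _ _ _ Q); assert (df1 := quarter_df1 _ _ _ _ _ _ _ _ Q).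
assert (dr1 := quarter_dr1 _ _ _ _ _ _ _ _ Q); assert (th1 := quarter_th1 _ _ _ _ _ _ _ _ Q).
set (A := 7 * PI / 18) in *.
set (Gf j x := sgn j * f (local j x)).
set (Gdf j x := sgn j * orient j * df (local j x)).
set (Gr j x := 1 * r (local j x)).
set (Gdr j x := 1 * orient j * dr (local j x)).
(* At an even node [n] the angle must be [A * n]; on a reversed cell it is counted back from the
   next even node. *)
set (Gth j x := A * IZR (start j) + orient j * th (local j x)).
assert (acc_f0 : forall s, acc_f q 0 s = 0) by (intros; unfold acc_f, Rdiv; ring).
assert (node : forall j, 
   (orient j = 1 /\ orient (j + 1) = -1 /\ sgn (j + 1) = sgn j /\
    local j (IZR j + 1) = 1 /\ local (j + 1) (IZR j + 1) = 1 /\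
    IZR (start (j + 1)) = IZR (start j) + 2) \/
   (orient j = -1 /\ orient (j + 1) = 1 /\ sgn (j + 1) = - sgn j /\
    local j (IZR j + 1) = 0 /\ local (j + 1) (IZR j + 1) = 0 /\
    IZR (start (j + 1)) = IZR (start j))).
  intros j; unfold local; destruct (cell_cases j) as
    [(E1 & E2 & E5 & E3 & E4)|(E1 & E2 & E5 & E3 & E4)]; rewrite E1, E2, E3, E4, E5, ?plus_IZR;
    [left|right]; repeat split; ring.
assert (F1 : forall x, is_derive (fun y => Gf (floor y) y) x (Gdf (floor x) x)).
  apply is_derive_glue; unfold Gf, Gdf.
  - intros j x _; apply is_derive_local, (quarter_df _ _ _ _ _ _ _ _ Q).
  - intros j; destruct (node j) as [(E1 & E2 & E3 & E4 & E5 & E6)|(E1 & E2 & E3 & E4 & E5 & E6)];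
      rewrite E3, E4, E5; rewrite ?f0; ring.
  - intros j; destruct (node j) as [(E1 & E2 & E3 & E4 & E5 & E6)|(E1 & E2 & E3 & E4 & E5 & E6)];
      rewrite E1, E2, E3, E4, E5; rewrite ?df1; ring.
assert (R1 : forall x, is_derive (fun y => Gr (floor y) y) x (Gdr (floor x) x)).
  apply is_derive_glue; unfold Gr, Gdr.
  - intros j x _; apply is_derive_local, (quarter_dr _ _ _ _ _ _ _ _ Q).
  - intros j; destruct (node j) as [(E1 & E2 & E3 & E4 & E5 & E6)|(E1 & E2 & E3 & E4 & E5 & E6)];
      rewrite E4, E5; ring.
  - intros j; destruct (node j) as [(E1 & E2 & E3 & E4 & E5 & E6)|(E1 & E2 & E3 & E4 & E5 & E6)];
      rewrite E1, E2, E4, E5; rewrite ?dr1, ?dr0; ring.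
assert (F2 : forall x, is_derive (fun y => Gdf (floor y) y) x
    (acc_f q (Gf (floor x) x) (Gr (floor x) x))).
  apply (is_derive_glue Gdf (fun j x => acc_f q (Gf j x) (Gr j x))); unfold Gf, Gdf, Gr.
  - intros j x Hx; rewrite acc_f_odd, Rmult_1_l by apply sgn_sq.
    replace (sgn j * acc_f q (f (local j x)) (r (local j x)))
      with (sgn j * orient j * orient j * acc_f q (f (local j x)) (r (local j x)))
      by (rewrite (Rmult_assoc (sgn j)), orient_sq; ring).
    apply is_derive_local, (quarter_f2 _ _ _ _ _ _ _ _ Q), local_range, Hx.
  - intros j; destruct (node j) as [(E1 & E2 & E3 & E4 & E5 & E6)|(E1 & E2 & E3 & E4 & E5 & E6)];
      rewrite E1, E2, E3, E4, E5; rewrite ?df1; ring.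
  - intros j; rewrite !acc_f_odd by apply sgn_sq.
    destruct (node j) as [(E1 & E2 & E3 & E4 & E5 & E6)|(E1 & E2 & E3 & E4 & E5 & E6)];
      rewrite E3, E4, E5; rewrite ?f0, ?acc_f0; ring.
assert (R2 : forall x, is_derive (fun y => Gdr (floor y) y) x
    (acc_r q m (Gf (floor x) x) (Gr (floor x) x))).
  apply (is_derive_glue Gdr (fun j x => acc_r q m (Gf j x) (Gr j x))); unfold Gf, Gdr, Gr.
  - intros j x Hx; rewrite acc_r_even by apply sgn_sq.
    replace (acc_r q m (f (local j x)) (1 * r (local j x)))
      with (1 * orient j * orient j * acc_r q m (f (local j x)) (r (local j x)))
      by (rewrite (Rmult_assoc 1), orient_sq, !Rmult_1_l; reflexivity).
    apply is_derive_local, (quarter_r2 _ _ _ _ _ _ _ _ Q), local_range, Hx.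
  - intros j; destruct (node j) as [(E1 & E2 & E3 & E4 & E5 & E6)|(E1 & E2 & E3 & E4 & E5 & E6)];
      rewrite E1, E2, E4, E5; rewrite ?dr1, ?dr0; ring.
  - intros j; rewrite !acc_r_even by apply sgn_sq.
    destruct (node j) as [(E1 & E2 & E3 & E4 & E5 & E6)|(E1 & E2 & E3 & E4 & E5 & E6)];
      rewrite E4, E5; reflexivity.
assert (T1 : forall x, is_derive (fun y => Gth (floor y) y) x (rate_th m (Gr (floor x) x))).
  apply (is_derive_glue Gth (fun j x => rate_th m (Gr j x))); unfold Gth, Gr.
  - intros j x Hx; rewrite Rmult_1_l.
    replace (rate_th m (r (local j x))) with
      (0 + orient j * orient j * rate_th m (r (local j x))) by (rewrite orient_sq; ring).
    apply (is_derive_plus (V := R_NormedModule) (fun _ => A * IZR (start j))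
      (fun y => orient j * th (local j y))).
      apply (is_derive_const (V := R_NormedModule)).
    apply is_derive_local, (quarter_dth _ _ _ _ _ _ _ _ Q), local_range, Hx.
  - intros j; destruct (node j) as [(E1 & E2 & E3 & E4 & E5 & E6)|(E1 & E2 & E3 & E4 & E5 & E6)];
      rewrite E1, E2, E4, E5, E6; rewrite ?th1, ?th0; ring.
  - intros j; destruct (node j) as [(E1 & E2 & E3 & E4 & E5 & E6)|(E1 & E2 & E3 & E4 & E5 & E6)];
      rewrite E4, E5; reflexivity.
assert (fl0 : floor 0 = 0%Z) by (apply floor_unique; lra).
assert (fl1 : floor 1 = 1%Z) by (apply floor_unique; lra).
(* A shift by 36 moves [j / 2] by 18, which is even, so the sign of [f] is kept as well as the
   direction. *)
assert (P : forall j, orient (j + 36) = orient j /\ sgn (j + 36) = sgn j /\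
    start (j + 36) = (start j + 36)%Z).
  intros j; unfold orient, sgn, start.
  replace (j + 36)%Z with (j + 18 * 2)%Z by ring; rewrite Z.div_add by lia.
  rewrite !Z.even_add, Z.even_mul.
  replace (Bool.eqb (Z.even j) (Z.even 18 || Z.even 2)) with (Z.even j)
    by (destruct (Z.even j); reflexivity).
  replace (Bool.eqb (Z.even (j / 2)) (Z.even 18)) with (Z.even (j / 2))
    by (destruct (Z.even (j / 2)); reflexivity).
  destruct (Z.even j); repeat split; lia.
assert (PL : forall j x, local (j + 36) (x + 36) = local j x).
  intros j x; destruct (P j) as (P1 & _ & P3); unfold local.
  rewrite P1, P3, plus_IZR; ring.
assert (PF : forall x, floor (x + 36) = (floor x + 36)%Z) by (intros; apply floor_add).
assert (l0 : local 0 0 = 0) by (unfold local, orient, start; simpl; ring).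
assert (l1 : local 1 1 = 1) by (unfold local, orient, start; simpl; ring).
exists (fun y => Gf (floor y) y), (fun y => Gdf (floor y) y), (fun y => Gr (floor y) y),
  (fun y => Gdr (floor y) y), (fun y => Gth (floor y) y).
constructor; try assumption.
- intros t; unfold Gr; rewrite Rmult_1_l; apply (quarter_r_pos _ _ _ _ _ _ _ _ Q).
  apply local_range; assert (H := floor_spec t); lra.
- unfold Gf; rewrite fl0, l0, f0; ring.
- unfold Gdf; rewrite fl0, l0, df0; unfold sgn, orient; simpl; ring.
- unfold Gr; rewrite fl0, l0, r0; ring.
- unfold Gdr; rewrite fl0, l0, dr0; ring.
- unfold Gth; rewrite fl0, l0, th0; unfold start; simpl; ring.
- unfold Gth; rewrite fl1, l1, th1; unfold start, orient; simpl; unfold A; field.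
- intros t; unfold Gf; rewrite PF, PL; destruct (P (floor t)) as (_ & -> & _); reflexivity.
- intros t; unfold Gr; rewrite PF, PL; reflexivity.
- intros t; unfold Gth; rewrite PF, PL; destruct (P (floor t)) as (-> & _ & ->).
  rewrite plus_IZR; unfold A; field.
Qed.

(** * Uniqueness *)

Definition gravity_f (f r : R) : R := - (400 / sqrt (r ^ 2 + 4 * f ^ 2) ^ 3) * f.

Definition gravity_r (a f r : R) : R :=
  100 * a ^ 2 / r ^ 3 - 25 / r ^ 2 - 200 * r / sqrt (r ^ 2 + 4 * f ^ 2) ^ 3.

Record motion_on (a : R) (I : R -> Prop) (f df r dr th : R -> R) : Prop := {
  motion_df : forall t, I t -> is_derive f t (df t);
  motion_dr : forall t, I t -> is_derive r t (dr t);
  motion_f2 : forall t, I t -> is_derive df t (gravity_f (f t) (r t));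
  motion_r2 : forall t, I t -> is_derive dr t (gravity_r a (f t) (r t));
  motion_dth : forall t, I t -> is_derive th t (10 * a / r t ^ 2);
  motion_r_pos : forall t, I t -> 0 < r t
}.

(** The radial equation contains [a] only through its square, so reversing time amounts to changing
    the sign of the angular momentum. Negative times in the uniqueness proof are thus reduced to
    positive ones. *)
Lemma motion_on_reverse a I f df r dr th : motion_on a I f df r dr th ->
  motion_on (- a) (fun t => I (- t)) (fun t => f (- t)) (fun t => - df (- t))
    (fun t => r (- t)) (fun t => - dr (- t)) (fun t => th (- t)).
Proof.
intros M.
assert (C : forall (g : R -> R) l t, is_derive g (- t) l -> is_derive (fun t => g (- t)) t (- l)).
  intros g l t Hg; replace (- l) with (- 1 * l) by ring.
  apply (is_derive_comp g Ropp); [exact Hg|auto_derive; auto; ring].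
assert (C' : forall (g : R -> R) l t, is_derive g (- t) l -> is_derive (fun t => - g (- t)) t l).
  intros g l t Hg; rewrite <- (Ropp_involutive l).
  now apply (is_derive_opp (fun t => g (- t))), C.
constructor; intros t Ht.
- now apply C, (motion_df _ _ _ _ _ _ _ M).
- now apply C, (motion_dr _ _ _ _ _ _ _ M).
- now apply C', (motion_f2 _ _ _ _ _ _ _ M).
- replace (gravity_r (- a) (f (- t)) (r (- t))) with (gravity_r a (f (- t)) (r (- t)))
    by (unfold gravity_r; replace ((- a) ^ 2) with (a ^ 2) by ring; reflexivity).
  now apply C', (motion_r2 _ _ _ _ _ _ _ M).
- replace (10 * - a / r (- t) ^ 2) with (- (10 * a / r (- t) ^ 2)) by (unfold Rdiv; ring).
  now apply C, (motion_dth _ _ _ _ _ _ _ M).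
- now apply (motion_r_pos _ _ _ _ _ _ _ M).
Qed.

Section Tame.

Variables M d : R.
Hypothesis d_pos : 0 < d.

Definition box (p : R * R) : Prop := Rabs (fst p) <= M /\ d <= snd p <= M.

Definition gap (p p' : R * R) : R := Rabs (fst p - fst p') + Rabs (snd p - snd p').

(** Bounded and Lipschitz together form a class closed under products; with the lower bound [d] on
    [r] it also covers the inverses and square roots of the force, without partial derivatives. *)
Definition tame (g : R * R -> R) : Prop := exists B K, 0 <= B /\ 0 <= K /\
  (forall p, box p -> Rabs (g p) <= B) /\
  (forall p p', box p -> box p' -> Rabs (g p - g p') <= K * gap p p').

Lemma tame_const c : tame (fun _ => c).
Proof.
exists (Rabs c), 0; repeat split; try apply Rabs_pos; try lra; intros; [lra|].
rewrite Rminus_diag, Rabs_R0; lra.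
Qed.

Lemma tame_fst : tame fst.
Proof.
exists (Rabs M), 1; repeat split; try apply Rabs_pos; try lra.
  intros p [H _]; eapply Rle_trans; [exact H|apply Rle_abs].
intros p p' _ _; unfold gap; assert (H := Rabs_pos (snd p - snd p')); lra.
Qed.

Lemma tame_snd : tame snd.
Proof.
exists (Rabs M), 1; repeat split; try apply Rabs_pos; try lra.
  intros p [_ H]; assert (H' := Rle_abs M); rewrite Rabs_pos_eq; lra.
intros p p' _ _; unfold gap; assert (H := Rabs_pos (fst p - fst p')); lra.
Qed.

Lemma tame_plus g h : tame g -> tame h -> tame (fun p => g p + h p).
Proof.
intros (B & K & HB & HK & H1 & H2) (C & L & HC & HL & H3 & H4).
exists (B + C), (K + L); repeat split; try lra.
  intros p Hp; eapply Rle_trans; [apply Rabs_triang|].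
  apply Rplus_le_compat; auto.
intros p p' Hp Hp'; rewrite Rmult_plus_distr_r.
replace (_ - _) with ((g p - g p') + (h p - h p')) by ring.
eapply Rle_trans; [apply Rabs_triang|].
apply Rplus_le_compat; auto.
Qed.

Lemma tame_mult g h : tame g -> tame h -> tame (fun p => g p * h p).
Proof.
intros (B & K & HB & HK & H1 & H2) (C & L & HC & HL & H3 & H4).
exists (B * C), (B * L + C * K); repeat split; try nra.
  intros p Hp; rewrite Rabs_mult; apply Rmult_le_compat; auto using Rabs_pos.
intros p p' Hp Hp'.
replace (_ - _) with (g p * (h p - h p') + h p' * (g p - g p')) by ring.
replace ((B * L + C * K) * gap p p') with (B * (L * gap p p') + C * (K * gap p p')) by ring.
eapply Rle_trans; [apply Rabs_triang|rewrite !Rabs_mult].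
apply Rplus_le_compat; apply Rmult_le_compat; auto using Rabs_pos.
Qed.

Lemma tame_inv g e : 0 < e -> (forall p, box p -> e <= g p) -> tame g -> tame (fun p => / g p).
Proof.
intros He Hg (B & K & HB & HK & H1 & H2).
assert (Ie := Rinv_0_lt_compat e He).
assert (Bd : forall p, box p -> Rabs (/ g p) <= / e).
  intros p Hp; assert (P := Hg p Hp).
  rewrite Rabs_pos_eq by (left; apply Rinv_0_lt_compat; lra).
  apply Rinv_le_contravar; lra.
exists (/ e), (/ e * / e * K); repeat split; [lra| |exact Bd|].
  repeat apply Rmult_le_pos; lra.
intros p p' Hp Hp'; assert (P := Hg p Hp); assert (P' := Hg p' Hp').
replace (/ g p - / g p') with (- (/ g p * / g p' * (g p - g p'))) by (field; lra).
rewrite Rabs_Ropp, !Rabs_mult, !Rmult_assoc.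
apply Rmult_le_compat; auto using Rabs_pos.
  apply Rmult_le_pos; apply Rabs_pos.
apply Rmult_le_compat; auto using Rabs_pos.
Qed.

Lemma tame_sqrt g e : 0 < e -> (forall p, box p -> e <= g p) -> tame g -> tame (fun p => sqrt (g p)).
Proof.
intros He Hg (B & K & HB & HK & H1 & H2).
assert (Se := sqrt_lt_R0 e He).
assert (Ie := Rinv_0_lt_compat _ Se).
exists (sqrt B), (/ sqrt e * K); repeat split; [apply sqrt_pos| | |].
- apply Rmult_le_pos; lra.
- intros p Hp; rewrite Rabs_pos_eq by apply sqrt_pos.
  apply sqrt_le_1_alt; eapply Rle_trans; [apply Rle_abs|auto].
- intros p p' Hp Hp'; assert (P := Hg p Hp); assert (P' := Hg p' Hp').
  assert (S1 := sqrt_le_1_alt _ _ P); assert (S2 := sqrt_lt_R0 (g p') ltac:(lra)).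
  replace (sqrt (g p) - sqrt (g p')) with (/ (sqrt (g p) + sqrt (g p')) * (g p - g p')).
    2:{ rewrite <- (sqrt_sqrt (g p)) at 2 by lra; rewrite <- (sqrt_sqrt (g p')) at 2 by lra.
        field; lra. }
  rewrite Rabs_mult, Rmult_assoc; apply Rmult_le_compat; auto using Rabs_pos.
  rewrite Rabs_pos_eq by (left; apply Rinv_0_lt_compat; lra).
  apply Rinv_le_contravar; lra.
Qed.

Lemma tame_pow g n : tame g -> tame (fun p => g p ^ n).
Proof.
intros Hg; induction n as [|n IH]; simpl; [apply tame_const|now apply tame_mult].
Qed.

Lemma tame_ext g h : (forall p, g p = h p) -> tame g -> tame h.
Proof.
intros E (B & K & HB & HK & H1 & H2); exists B, K;
  repeat split; auto; intros; rewrite <- !E; auto.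
Qed.

Lemma tame_inv_sep3 : tame (fun p => / sqrt (snd p ^ 2 + 4 * fst p ^ 2) ^ 3).
Proof.
assert (Hd : 0 < d ^ 2) by nra.
assert (L : forall p, box p -> d ^ 2 <= snd p ^ 2 + 4 * fst p ^ 2).
  intros p [_ Hp]; nra.
apply tame_inv with (sqrt (d ^ 2) ^ 3).
- now apply pow_lt, sqrt_lt_R0.
- intros p Hp; apply pow_incr; split; [apply sqrt_pos|now apply sqrt_le_1_alt, L].
- apply tame_pow, tame_sqrt with (d ^ 2); auto.
  apply tame_plus; [apply tame_pow, tame_snd|].
  apply tame_mult; [apply tame_const|apply tame_pow, tame_fst].
Qed.

Lemma tame_inv_pow n : tame (fun p => / snd p ^ n).
Proof.
apply tame_inv with (d ^ n).
- now apply pow_lt.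
- intros p [_ Hp]; apply pow_incr; lra.
- apply tame_pow, tame_snd.
Qed.

Lemma tame_gravity_f : tame (fun p => gravity_f (fst p) (snd p)).
Proof.
apply (tame_ext (fun p => (-400 * / sqrt (snd p ^ 2 + 4 * fst p ^ 2) ^ 3) * fst p)).
  intros p; unfold gravity_f, Rdiv; ring.
apply tame_mult; [apply tame_mult|apply tame_fst];
  [apply tame_const|apply tame_inv_sep3].
Qed.

Lemma tame_gravity_r a : tame (fun p => gravity_r a (fst p) (snd p)).
Proof.
apply (tame_ext (fun p => (100 * a ^ 2 * / snd p ^ 3 + -25 * / snd p ^ 2)
  + -200 * snd p * / sqrt (snd p ^ 2 + 4 * fst p ^ 2) ^ 3)).
  intros p; unfold gravity_r, Rdiv; ring.
apply tame_plus; [apply tame_plus|]; apply tame_mult;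
  auto using tame_const, tame_inv_pow, tame_inv_sep3, tame_mult, tame_snd.
Qed.

End Tame.

(** [D s * exp (- K * s)] is nonincreasing and starts at 0; the comparison is applied with the zero
    function on its smaller side. *)
Lemma gronwall_zero (D dD : R -> R) (K t : R) : 0 <= t ->
  (forall s, 0 <= s <= t -> is_derive D s (dD s)) ->
  (forall s, 0 <= s <= t -> dD s <= K * D s) -> D 0 = 0 -> D t <= 0.
Proof.
intros Ht HD HK D0.
assert (H := increment_bound (fun _ => 0) (fun s => - D s * exp (- K * s)) (fun _ => 0)
  (fun s => (K * D s - dD s) * exp (- K * s)) t Ht).
simpl in H; rewrite D0, Rminus_diag, Rabs_R0 in H.
assert (E := exp_pos (- K * t)).
assert (P : 0 <= - D t * exp (- K * t) - - 0 * exp (- K * 0)).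
  apply H; intros s Hs.
  - apply (is_derive_const (V := R_NormedModule)).
  - auto_derive; [exists (dD s); now apply HD|].
    replace (Derive _ _) with (dD s) by (symmetry; apply is_derive_unique, HD, Hs).
    ring.
  - apply Rmult_le_pos; [|left; apply exp_pos].
    assert (Q := HK s Hs); lra.
nra.
Qed.

Lemma bounded_on_segment (f : R -> R) (t : R) : 0 <= t ->
  (forall s, 0 <= s <= t -> continuous f s) ->
  exists M, forall s, 0 <= s <= t -> Rabs (f s) <= M.
Proof.
intros Ht Hf.
destruct (continuity_ab_maj (fun s => Rabs (f s)) 0 t Ht) as (x & Hx & _).
  intros s Hs; apply continuity_pt_filterlim.
  apply (continuous_comp f Rabs); [now apply Hf|apply continuous_Rabs].
exists (Rabs (f x)); exact Hx.
Qed.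

Lemma positive_on_segment (f : R -> R) (t : R) : 0 <= t ->
  (forall s, 0 <= s <= t -> continuous f s) -> (forall s, 0 <= s <= t -> 0 < f s) ->
  exists d, 0 < d /\ forall s, 0 <= s <= t -> d <= f s.
Proof.
intros Ht Hf Hp.
destruct (continuity_ab_min f 0 t Ht) as (x & Hx & Hx').
  intros s Hs; apply continuity_pt_filterlim; now apply Hf.
exists (f x); split; [now apply Hp|exact Hx].
Qed.

(** On a compact segment both motions stay in a common box with [r] bounded below, where the force
    is Lipschitz. Gronwall for the squared distance in phase space settles [f] and [r]; the angles
    then have equal derivatives. *)
Lemma motion_unique_forward a t f df r dr th f' df' r' dr' th' : 0 <= t ->
  let I s := 0 <= s <= t in
  motion_on a I f df r dr th -> motion_on a I f' df' r' dr' th' ->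
  f 0 = f' 0 -> df 0 = df' 0 -> r 0 = r' 0 -> dr 0 = dr' 0 -> th 0 = th' 0 ->
  f t = f' t /\ r t = r' t /\ th t = th' t.
Proof.
intros Ht I M M' E1 E2 E3 E4 E5.
assert (cont_of : forall g dg : R -> R, (forall s, I s -> is_derive g s (dg s)) ->
  forall s, 0 <= s <= t -> continuous g s).
  intros g dg Hg s Hs; eapply is_derive_continuous, Hg, Hs.
assert (cf := cont_of _ _ (motion_df _ _ _ _ _ _ _ M)).
assert (cf' := cont_of _ _ (motion_df _ _ _ _ _ _ _ M')).
assert (cr := cont_of _ _ (motion_dr _ _ _ _ _ _ _ M)).
assert (cr' := cont_of _ _ (motion_dr _ _ _ _ _ _ _ M')).
destruct (bounded_on_segment f t Ht cf) as [B1 HB1].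
destruct (bounded_on_segment f' t Ht cf') as [B2 HB2].
destruct (bounded_on_segment r t Ht cr) as [B3 HB3].
destruct (bounded_on_segment r' t Ht cr') as [B4 HB4].
destruct (positive_on_segment r t Ht cr (motion_r_pos _ _ _ _ _ _ _ M)) as (d1 & Hd1 & Hr).
destruct (positive_on_segment r' t Ht cr' (motion_r_pos _ _ _ _ _ _ _ M')) as (d2 & Hd2 & Hr').
set (B := Rmax (Rmax B1 B2) (Rmax B3 B4)); set (d := Rmin d1 d2).
assert (Hd : 0 < d) by now apply Rmin_glb_lt.
assert (bx : forall s, I s -> box B d (f s, r s)).
  intros s Hs; specialize (HB1 s Hs); specialize (HB3 s Hs); specialize (Hr s Hs).
  assert (A := Rle_abs (r s)).
  assert (X1 := Rmax_l (Rmax B1 B2) (Rmax B3 B4)); assert (X2 := Rmax_r (Rmax B1 B2) (Rmax B3 B4)).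
  assert (X3 := Rmax_l B1 B2); assert (X4 := Rmax_l B3 B4); assert (X5 := Rmin_l d1 d2).
  unfold box, B, d; simpl; lra.
assert (bx' : forall s, I s -> box B d (f' s, r' s)).
  intros s Hs; specialize (HB2 s Hs); specialize (HB4 s Hs); specialize (Hr' s Hs).
  assert (A := Rle_abs (r' s)).
  assert (X1 := Rmax_l (Rmax B1 B2) (Rmax B3 B4)); assert (X2 := Rmax_r (Rmax B1 B2) (Rmax B3 B4)).
  assert (X3 := Rmax_r B1 B2); assert (X4 := Rmax_r B3 B4); assert (X5 := Rmin_r d1 d2).
  unfold box, B, d; simpl; lra.
destruct (tame_gravity_f B d Hd) as (_ & K & _ & HK & _ & LK).
destruct (tame_gravity_r B d Hd a) as (_ & L & _ & HL & _ & LL).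
set (D s := (f s - f' s) ^ 2 + (df s - df' s) ^ 2 + (r s - r' s) ^ 2 + (dr s - dr' s) ^ 2).
set (dD s := 2 * (f s - f' s) * (df s - df' s)
  + 2 * (df s - df' s) * (gravity_f (f s) (r s) - gravity_f (f' s) (r' s))
  + 2 * (r s - r' s) * (dr s - dr' s)
  + 2 * (dr s - dr' s) * (gravity_r a (f s) (r s) - gravity_r a (f' s) (r' s))).
assert (D2 : forall (g dg h dh : R -> R) s, is_derive g s (dg s) -> is_derive h s (dh s) ->
  is_derive (fun s => (g s - h s) ^ 2) s (2 * (g s - h s) * (dg s - dh s))).
  intros g dg h dh s Hg Hh; auto_derive.
    split; [now exists (dg s)|split; [now exists (dh s)|auto]].
  replace (Derive (fun x => g x) s) with (dg s) by (symmetry; now apply is_derive_unique).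
  replace (Derive (fun x => h x) s) with (dh s) by (symmetry; now apply is_derive_unique).
  ring.
assert (HD : forall u, I u -> D u <= 0).
  intros u Hu; assert (sub : forall s, 0 <= s <= u -> I s) by (unfold I in *; intros; lra).
  (* The 1 comes from the position terms by [2 x y <= x^2 + y^2]; the same inequality on each force
     term costs at most twice its Lipschitz constant. *)
  apply (gronwall_zero D dD (1 + 2 * K + 2 * L) u (proj1 Hu)).
  - intros s Hs; apply sub in Hs; unfold D, dD.
    repeat apply (is_derive_plus (V := R_NormedModule));
      [apply D2|apply (D2 df (fun s => gravity_f (f s) (r s)) df' (fun s => gravity_f (f' s) (r' s)))
      |apply D2|apply (D2 dr (fun s => gravity_r a (f s) (r s)) dr' (fun s => gravity_r a (f' s) (r' s)))].
    + now apply (motion_df _ _ _ _ _ _ _ M).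
    + now apply (motion_df _ _ _ _ _ _ _ M').
    + now apply (motion_f2 _ _ _ _ _ _ _ M).
    + now apply (motion_f2 _ _ _ _ _ _ _ M').
    + now apply (motion_dr _ _ _ _ _ _ _ M).
    + now apply (motion_dr _ _ _ _ _ _ _ M').
    + now apply (motion_r2 _ _ _ _ _ _ _ M).
    + now apply (motion_r2 _ _ _ _ _ _ _ M').
  - intros s Hs; apply sub in Hs.
    assert (L1 := LK _ _ (bx s Hs) (bx' s Hs)); assert (L2 := LL _ _ (bx s Hs) (bx' s Hs)).
    unfold gap in L1, L2; simpl in L1, L2; unfold D, dD.
    set (x := f s - f' s) in *; set (x1 := df s - df' s) in *.
    set (y := r s - r' s) in *; set (y1 := dr s - dr' s) in *.
    set (G := gravity_f _ _ - _) in *; set (H := gravity_r _ _ _ - _) in *.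
    assert (amgm : forall v w, 2 * Rabs v * Rabs w <= v ^ 2 + w ^ 2).
      intros v w; rewrite <- (pow2_abs v), <- (pow2_abs w); assert (Q := pow2_ge_0 (Rabs v - Rabs w)); lra.
    assert (prod : forall v w, 2 * v * w <= 2 * Rabs v * Rabs w).
      intros v w; assert (Q := Rle_abs (v * w)); rewrite Rabs_mult in Q; lra.
    assert (T : forall w Z N, 0 <= N -> Rabs Z <= N * (Rabs x + Rabs y) ->
      2 * w * Z <= N * (2 * w ^ 2 + x ^ 2 + y ^ 2)).
      intros w Z N HN HZ; eapply Rle_trans; [apply prod|].
      assert (Q1 := amgm w x); assert (Q2 := amgm w y).
      apply Rle_trans with (N * (2 * Rabs w * Rabs x + 2 * Rabs w * Rabs y)).
        replace (N * (2 * Rabs w * Rabs x + 2 * Rabs w * Rabs y))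
          with (2 * Rabs w * (N * (Rabs x + Rabs y))) by ring.
        apply Rmult_le_compat_l; [assert (Q := Rabs_pos w); lra|exact HZ].
      apply Rmult_le_compat_l; lra.
    assert (T1 := T x1 G K HK L1); assert (T2 := T y1 H L HL L2).
    assert (T3 := Rle_trans _ _ _ (prod x x1) (amgm x x1)).
    assert (T4 := Rle_trans _ _ _ (prod y y1) (amgm y y1)).
    assert (Kx := Rmult_le_pos _ _ HK (pow2_ge_0 x)); assert (Ky := Rmult_le_pos _ _ HK (pow2_ge_0 y)).
    assert (Ky1 := Rmult_le_pos _ _ HK (pow2_ge_0 y1)).
    assert (Lx := Rmult_le_pos _ _ HL (pow2_ge_0 x)); assert (Ly := Rmult_le_pos _ _ HL (pow2_ge_0 y)).
    assert (Lx1 := Rmult_le_pos _ _ HL (pow2_ge_0 x1)).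
    lra.
  - unfold D; rewrite E1, E2, E3, E4; ring.
assert (E : forall u, I u -> f u = f' u /\ r u = r' u).
  intros u Hu; assert (H := HD u Hu); unfold D in H.
  assert (Q1 := pow2_ge_0 (f u - f' u)); assert (Q2 := pow2_ge_0 (df u - df' u)).
  assert (Q3 := pow2_ge_0 (r u - r' u)); assert (Q4 := pow2_ge_0 (dr u - dr' u)).
  assert (Z : forall x, x ^ 2 <= 0 -> x = 0).
    intros x Hx; apply Rsqr_0_uniq; rewrite Rsqr_pow2; assert (Q := pow2_ge_0 x); lra.
  split; apply Rminus_diag_uniq, Z; lra.
assert (It : I t) by (unfold I; lra).
split; [now apply E|split; [now apply E|]].
assert (H := increment_bound (fun s => th s - th' s) (fun _ => 0) (fun _ => 0) (fun _ => 0) t Ht).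
simpl in H; rewrite E5, !Rminus_diag, Rminus_0_r in H.
apply Rminus_diag_uniq.
assert (P : Rabs (th t - th' t) <= 0).
  apply H; intros s Hs.
  - replace 0 with (10 * a / r s ^ 2 - 10 * a / r' s ^ 2)
      by (rewrite (proj2 (E s Hs)); ring).
    apply (is_derive_minus (V := R_NormedModule) th th');
      [now apply (motion_dth _ _ _ _ _ _ _ M)|now apply (motion_dth _ _ _ _ _ _ _ M')].
  - apply (is_derive_const (V := R_NormedModule)).
  - rewrite Rabs_R0; lra.
destruct (Req_dec (th t - th' t) 0) as [|N]; [assumption|].
apply Rabs_pos_lt in N; lra.
Qed.

Lemma motion_on_sub a (I J : R -> Prop) f df r dr th : (forall t, J t -> I t) ->
  motion_on a I f df r dr th -> motion_on a J f df r dr th.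
Proof. intros HJ [H1 H2 H3 H4 H5 H6]; constructor; auto. Qed.

Lemma motion_unique a lo hi f df r dr th f' df' r' dr' th' :
  let I := in_interval lo hi in I 0 ->
  motion_on a I f df r dr th -> motion_on a I f' df' r' dr' th' ->
  f 0 = f' 0 -> df 0 = df' 0 -> r 0 = r' 0 -> dr 0 = dr' 0 -> th 0 = th' 0 ->
  forall t, I t -> f t = f' t /\ r t = r' t /\ th t = th' t.
Proof.
intros I I0 M M' E1 E2 E3 E4 E5 t It.
assert (conv : forall x y s, I x -> I y -> x <= s <= y -> I s).
  intros x y s [Hx _] [_ Hy] Hs; split.
    now apply Rbar_lt_le_trans with x.
  now apply Rbar_le_lt_trans with y.
destruct (Rle_dec 0 t) as [P|P].
- apply (motion_unique_forward a t f df r dr th f' df' r' dr' th' P); try assumption;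
    eapply motion_on_sub; try eassumption; intros s Hs; now apply (conv 0 t).
- assert (sub : forall s, 0 <= s <= - t -> I (- s))
    by (intros s Hs; apply (conv t 0); auto; lra).
  apply motion_on_reverse in M; apply motion_on_reverse in M'.
  apply (motion_on_sub _ _ (fun s => 0 <= s <= - t)) in M; [|exact sub].
  apply (motion_on_sub _ _ (fun s => 0 <= s <= - t)) in M'; [|exact sub].
  assert (H := motion_unique_forward _ (- t) _ _ _ _ _ _ _ _ _ _ ltac:(lra) M M').
  simpl in H; rewrite Ropp_0, Ropp_involutive in H; apply H; congruence.
Qed.

Lemma is_solution_motion a b lo hi f r th : is_solution a b lo hi f r th ->
  motion_on a (in_interval lo hi) f (Derive f) r (Derive r) th.
Proof.
intros S; constructor; intros t Ht.
- apply Derive_correct; now apply (sol_f_diff _ _ _ _ _ _ _ S).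
- apply Derive_correct; now apply (sol_r_diff _ _ _ _ _ _ _ S).
- exact (sol_f_eq _ _ _ _ _ _ _ S t Ht).
- exact (sol_r_eq _ _ _ _ _ _ _ S t Ht).
- assert (H := sol_theta_eq _ _ _ _ _ _ _ S t Ht).
  assert (P := sol_r_pos _ _ _ _ _ _ _ S t Ht).
  replace (10 * a / r t ^ 2) with (Derive th t) by (rewrite <- H; field; lra).
  apply Derive_correct; now apply (sol_theta_diff _ _ _ _ _ _ _ S).
- now apply (sol_r_pos _ _ _ _ _ _ _ S).
Qed.

(** Every interval lies in the whole line, so extending all other solutions is just uniqueness on
    their intervals. *)
Lemma motion_on_maximal a b f df r dr th :
  motion_on a (fun _ => True) f df r dr th ->
  f 0 = 0 -> df 0 = b -> r 0 = 10 -> dr 0 = 0 -> th 0 = 0 ->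
  is_maximal_solution a b m_infty p_infty f r th.
Proof.
intros M E1 E2 E3 E4 E5.
assert (Df : forall t, Derive f t = df t)
  by (intros t; apply is_derive_unique; now apply (motion_df _ _ _ _ _ _ _ M)).
assert (Dr : forall t, Derive r t = dr t)
  by (intros t; apply is_derive_unique; now apply (motion_dr _ _ _ _ _ _ _ M)).
assert (Dth : forall t, Derive th t = 10 * a / r t ^ 2)
  by (intros t; apply is_derive_unique; now apply (motion_dth _ _ _ _ _ _ _ M)).
split.
- constructor; rewrite ?Df, ?Dr; auto.
  + split; exact I.
  + intros t _; now apply (motion_r_pos _ _ _ _ _ _ _ M).
  + intros t _; exists (df t); now apply (motion_df _ _ _ _ _ _ _ M).
  + intros t _; exists (dr t); now apply (motion_dr _ _ _ _ _ _ _ M).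
  + intros t _; eexists; now apply (motion_dth _ _ _ _ _ _ _ M).
  + intros t _; apply (is_derive_ext df (Derive f)); [now intros s|].
    now apply (motion_f2 _ _ _ _ _ _ _ M).
  + intros t _; apply (is_derive_ext dr (Derive r)); [now intros s|].
    now apply (motion_r2 _ _ _ _ _ _ _ M).
  + intros t _; rewrite Dth; assert (P := motion_r_pos _ _ _ _ _ _ _ M t I); field; lra.
- intros lo hi f' r' th' S; split; [|split].
  + destruct lo; exact I.
  + destruct hi; exact I.
  + apply (motion_unique a lo hi f' (Derive f') r' (Derive r') th' f df r dr th).
    * exact (sol_zero_in _ _ _ _ _ _ _ S).
    * now apply is_solution_motion with b.
    * apply (motion_on_sub _ (fun _ => True)); auto.
    * rewrite E1; exact (sol_f_0 _ _ _ _ _ _ _ S).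
    * rewrite E2; exact (sol_df_0 _ _ _ _ _ _ _ S).
    * rewrite E3; exact (sol_r_0 _ _ _ _ _ _ _ S).
    * rewrite E4; exact (sol_dr_0 _ _ _ _ _ _ _ S).
    * rewrite E5; exact (sol_theta_0 _ _ _ _ _ _ _ S).
Qed.

(** * The three bodies *)

Lemma is_derive_pair {V W : NormedModule R_AbsRing} (f : R -> V) (g : R -> W) (t : R) df dg :
  is_derive f t df -> is_derive g t dg -> is_derive (fun s => (f s, g s)) t (df, dg).
Proof.
intros Hf Hg.
apply (filterdiff_ext_lin _ (fun y : R_AbsRing => (scal y df, scal y dg))); [|reflexivity].
apply (filterdiff_comp'_2 f g pair t (fun y : R_AbsRing => scal y df)
  (fun y : R_AbsRing => scal y dg) pair Hf Hg).
apply (filterdiff_linear (fun u : V * W => (fst u, snd u))).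
apply is_linear_prod; [apply is_linear_fst|apply is_linear_snd].
Qed.

Lemma is_derive_vec3 (x y z : R -> R) (t dx dy dz : R) :
  is_derive x t dx -> is_derive y t dy -> is_derive z t dz ->
  is_derive (fun s => (x s, y s, z s) : vec3) t (dx, dy, dz).
Proof. intros; now repeat apply is_derive_pair. Qed.

Lemma norm_vec3 (x y z : R) : norm ((x, y, z) : vec3) = sqrt (x ^ 2 + y ^ 2 + z ^ 2).
Proof.
change (norm _) with (sqrt (sqrt (Rabs x ^ 2 + Rabs y ^ 2) ^ 2 + Rabs z ^ 2)).
rewrite !pow2_abs, pow2_sqrt; [reflexivity|].
assert (H := pow2_ge_0 x); assert (H' := pow2_ge_0 y); lra.
Qed.

Lemma attraction_eq m p i j xi yi zi xj yj zj d : p i = (xi, yi, zi) -> p j = (xj, yj, zj) ->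
  0 <= d -> (xj - xi) ^ 2 + (yj - yi) ^ 2 + (zj - zi) ^ 2 = d ^ 2 ->
  attraction m p i j =
    (m j / d ^ 3 * (xj - xi), m j / d ^ 3 * (yj - yi), m j / d ^ 3 * (zj - zi)).
Proof.
intros Hi Hj Hd E; unfold attraction; rewrite Hi, Hj.
change (minus (xj, yj, zj) (xi, yi, zi)) with ((xj - xi, yj - yi, zj - zi) : vec3).
rewrite norm_vec3, E, sqrt_pow2 by exact Hd; reflexivity.
Qed.

Lemma vec3_eq (x y z x' y' z' : R) : x = x' -> y = y' -> z = z' ->
  ((x, y, z) : vec3) = (x', y', z').
Proof. now intros -> -> ->. Qed.

Lemma motion_three_body a f df r dr th : motion_on a (fun _ => True) f df r dr th ->
  three_body_solution masses (motion f r th).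
Proof.
intros M.
assert (Hr : forall t, 0 < r t) by (intros; now apply (motion_r_pos _ _ _ _ _ _ _ M)).
assert (pyth : forall t, cos (th t) ^ 2 + sin (th t) ^ 2 = 1).
  intros t; assert (H := sin2_cos2 (th t)); unfold Rsqr in H; lra.
split.
- assert (N : forall t, r t * cos (th t) = 0 -> r t * sin (th t) = 0 -> False).
    intros t H1 H2; specialize (Hr t); specialize (pyth t).
    apply Rmult_integral in H1; apply Rmult_integral in H2.
    destruct H1 as [H1|H1]; [lra|]; destruct H2 as [H2|H2]; [lra|].
    rewrite H1, H2 in pyth; lra.
  intros t i j Hi Hj Hij E.
  destruct i as [|[|[|i]]]; destruct j as [|[|[|j]]]; try lia; simpl in E;
    injection E; intros; apply (N t); lra.
(* The velocity in polar form, with tangential speed [r * th' = 10 * a / r]. *)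
- exists (fun i t => match i with
    | O => (0, 0, df t)
    | S O => (dr t * cos (th t) - 10 * a / r t * sin (th t),
              dr t * sin (th t) + 10 * a / r t * cos (th t), - df t)
    | _ => (- (dr t * cos (th t) - 10 * a / r t * sin (th t)),
            - (dr t * sin (th t) + 10 * a / r t * cos (th t)), - df t)
    end).
  intros t i Hi.
  assert (r0 := Hr t); assert (p1 := pyth t).
  assert (Df := motion_df _ _ _ _ _ _ _ M t I); assert (Dr := motion_dr _ _ _ _ _ _ _ M t I).
  assert (Df2 := motion_f2 _ _ _ _ _ _ _ M t I); assert (Dr2 := motion_r2 _ _ _ _ _ _ _ M t I).
  assert (Dth := motion_dth _ _ _ _ _ _ _ M t I).
  set (s := sqrt (r t ^ 2 + 4 * f t ^ 2)).
  assert (s0 : 0 < s) by (apply sqrt_lt_R0; nra).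
  assert (s2 : s ^ 2 = r t ^ 2 + 4 * f t ^ 2) by (apply pow2_sqrt; nra).
  assert (eqD : forall (g : R -> R) l, is_derive g t l -> Derive (fun x => g x) t = l)
    by (intros; now apply is_derive_unique).
  assert (Dx : is_derive (fun t => r t * cos (th t)) t
      (dr t * cos (th t) - 10 * a / r t * sin (th t))).
    auto_derive; [repeat split; eexists; eassumption|].
    rewrite (eqD r _ Dr), (eqD th _ Dth); field; lra.
  assert (Dy : is_derive (fun t => r t * sin (th t)) t
      (dr t * sin (th t) + 10 * a / r t * cos (th t))).
    auto_derive; [repeat split; eexists; eassumption|].
    rewrite (eqD r _ Dr), (eqD th _ Dth); field; lra.
  (* The inward pull on an outer body: its twin, of mass 100 at distance [2 r], gives [25 / r^2],
     the body of mass 200 at distance [s] the rest. The term [100 a^2 / r^3] cancels against the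
     centripetal one. *)
  set (k := 25 / r t ^ 2 + 200 * r t / s ^ 3).
  assert (Dx2 : is_derive (fun t => dr t * cos (th t) - 10 * a / r t * sin (th t)) t
      (- k * cos (th t))).
    auto_derive; [repeat split; try (eexists; eassumption); lra|].
    rewrite (eqD r _ Dr), (eqD th _ Dth), (eqD dr _ Dr2).
    unfold gravity_r; fold s; unfold k; field; lra.
  assert (Dy2 : is_derive (fun t => dr t * sin (th t) + 10 * a / r t * cos (th t)) t
      (- k * sin (th t))).
    auto_derive; [repeat split; try (eexists; eassumption); lra|].
    rewrite (eqD r _ Dr), (eqD th _ Dth), (eqD dr _ Dr2).
    unfold gravity_r; fold s; unfold k; field; lra.
  assert (opp : forall (g : R -> R) l, is_derive g t l -> is_derive (fun t => - g t) t (- l))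
    by (intros; now apply (is_derive_opp (V := R_NormedModule))).
  unfold gravity_f in Df2; fold s in Df2.
  set (c := cos (th t)) in *; set (n := sin (th t)) in *.
  assert (zero_eq : (zero : vec3) = (0, 0, 0)) by reflexivity.
  assert (sum3 : forall g : nat -> vec3, sum_n g 2 = plus (plus (g 0%nat) (g 1%nat)) (g 2%nat))
    by (intros; now rewrite !sum_Sn, sum_O).
  assert (plus_eq : forall x y z x' y' z' : R,
    plus ((x, y, z) : vec3) (x', y', z') = (x + x', y + y', z + z')) by reflexivity.
  rewrite sum3.
  destruct i as [|[|[|i]]]; [| | |lia]; cbn [Nat.eqb].
  + split; [apply is_derive_vec3; try assumption; apply (is_derive_const (V := R_NormedModule))|].
    rewrite (attraction_eq _ _ 0 1 0 0 (f t) (r t * c) (r t * n) (- f t) s),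
      (attraction_eq _ _ 0 2 0 0 (f t) (- (r t * c)) (- (r t * n)) (- f t) s),
      zero_eq, !plus_eq;
      try reflexivity; try lra;
      try (rewrite s2; replace (r t ^ 2) with (r t ^ 2 * (c ^ 2 + n ^ 2)) by (rewrite p1; ring); ring).
    simpl masses.
    match goal with |- is_derive _ _ ?v => replace v with ((0, 0, - (400 / s ^ 3) * f t) : vec3) end.
      apply is_derive_vec3; try assumption; apply (is_derive_const (V := R_NormedModule)).
    apply vec3_eq; field; lra.
  + split; [apply is_derive_vec3; auto|].
    rewrite (attraction_eq _ _ 1 0 (r t * c) (r t * n) (- f t) 0 0 (f t) s),
      (attraction_eq _ _ 1 2 (r t * c) (r t * n) (- f t) (- (r t * c)) (- (r t * n)) (- f t) (2 * r t)),
      zero_eq, !plus_eq;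
      try reflexivity; try lra;
      try (rewrite s2; replace (r t ^ 2) with (r t ^ 2 * (c ^ 2 + n ^ 2)) by (rewrite p1; ring); ring);
      try (replace ((2 * r t) ^ 2) with (4 * r t ^ 2 * (c ^ 2 + n ^ 2)) by (rewrite p1; ring); ring).
    simpl masses.
    match goal with |- is_derive _ _ ?v => replace v with
      ((- k * c, - k * n, - (- (400 / s ^ 3) * f t)) : vec3) end.
      apply is_derive_vec3; auto.
    apply vec3_eq; unfold k; field; lra.
  + split; [apply is_derive_vec3; auto|].
    rewrite (attraction_eq _ _ 2 0 (- (r t * c)) (- (r t * n)) (- f t) 0 0 (f t) s),
      (attraction_eq _ _ 2 1 (- (r t * c)) (- (r t * n)) (- f t) (r t * c) (r t * n) (- f t) (2 * r t)),
      zero_eq, !plus_eq;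
      try reflexivity; try lra;
      try (rewrite s2; replace (r t ^ 2) with (r t ^ 2 * (c ^ 2 + n ^ 2)) by (rewrite p1; ring); ring);
      try (replace ((2 * r t) ^ 2) with (4 * r t ^ 2 * (c ^ 2 + n ^ 2)) by (rewrite p1; ring); ring).
    simpl masses.
    match goal with |- is_derive _ _ ?v => replace v with
      ((- (- k * c), - (- k * n), - (- (400 / s ^ 3) * f t)) : vec3) end.
      apply is_derive_vec3; auto.
    apply vec3_eq; unfold k; field; lra.
Qed.

Lemma global_rescaled c q m f df r dr th : 0 < q -> global c q m f df r dr th ->
  let T := sqrt q in
  motion_on (10 * m / T) (fun _ => True) (fun t => 10 * f (/ T * t)) (fun t => 10 / T * df (/ T * t))
    (fun t => 10 * r (/ T * t)) (fun t => 10 / T * dr (/ T * t)) (fun t => th (/ T * t)).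
Proof.
intros Hq G T.
assert (HT : 0 < T) by now apply sqrt_lt_R0.
assert (T2 : q = T * T) by (symmetry; apply sqrt_sqrt; lra).
assert (C : forall k (g : R -> R) t l, is_derive g (/ T * t) l ->
    is_derive (fun t => k * g (/ T * t)) t (k * (/ T * l))).
  intros k g t l Hg; apply (is_derive_scal (fun t => g (/ T * t))).
  apply (is_derive_comp g (fun t => / T * t)); [exact Hg|auto_derive; auto; ring].
assert (sqrt_eq : forall t, sqrt ((10 * r t) ^ 2 + 4 * (10 * f t) ^ 2) = 10 * sep (f t) (r t)).
  intros t; replace ((10 * r t) ^ 2 + 4 * (10 * f t) ^ 2)
    with (10 ^ 2 * (r t ^ 2 + 4 * f t ^ 2)) by ring.
  assert (P := sep_arg_pos (f t) (r t) (global_r_pos _ _ _ _ _ _ _ _ G t)).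
  rewrite sqrt_mult_alt, sqrt_pow2 by lra; reflexivity.
constructor; intros t _.
- replace (10 / T * df (/ T * t)) with (10 * (/ T * df (/ T * t))) by (field; lra).
  apply C, (global_df _ _ _ _ _ _ _ _ G).
- replace (10 / T * dr (/ T * t)) with (10 * (/ T * dr (/ T * t))) by (field; lra).
  apply C, (global_dr _ _ _ _ _ _ _ _ G).
- assert (R0 := global_r_pos _ _ _ _ _ _ _ _ G (/ T * t)).
  assert (S0 := sep_pos (f (/ T * t)) _ R0).
  replace (gravity_f _ _) with (10 / T * (/ T * acc_f q (f (/ T * t)) (r (/ T * t)))).
    apply C, (global_f2 _ _ _ _ _ _ _ _ G).
  unfold gravity_f, acc_f; rewrite sqrt_eq, T2; field; lra.
- assert (R0 := global_r_pos _ _ _ _ _ _ _ _ G (/ T * t)).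
  assert (S0 := sep_pos (f (/ T * t)) _ R0).
  replace (gravity_r _ _ _) with (10 / T * (/ T * acc_r q m (f (/ T * t)) (r (/ T * t)))).
    apply C, (global_r2 _ _ _ _ _ _ _ _ G).
  unfold gravity_r, acc_r; rewrite sqrt_eq, T2; field; lra.
- assert (R0 := global_r_pos _ _ _ _ _ _ _ _ G (/ T * t)).
  replace (10 * _ / _) with (1 * (/ T * rate_th m (r (/ T * t))))
    by (unfold rate_th; field; lra).
  apply (is_derive_ext (fun t => 1 * th (/ T * t))); [intros; apply Rmult_1_l|].
  apply C, (global_dth _ _ _ _ _ _ _ _ G).
- assert (R0 := global_r_pos _ _ _ _ _ _ _ _ G (/ T * t)); lra.
Qed.

Lemma global_periodic c q m f df r dr th : 0 < q -> global c q m f df r dr th ->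
  let T := sqrt q in
  periodic_motion (36 * T) (motion (fun t => 10 * f (/ T * t)) (fun t => 10 * r (/ T * t))
    (fun t => th (/ T * t))).
Proof.
intros Hq G T.
assert (HT : 0 < T) by now apply sqrt_lt_R0.
split; [lra|intros t i _].
assert (E : / T * (t + 36 * T) = / T * t + 36) by (field; lra).
assert (Hc : forall x, cos (x + 14 * PI) = cos x)
  by (intros x; replace (x + 14 * PI) with (x + 2 * INR 7 * PI) by (simpl; ring); apply cos_period).
assert (Hs : forall x, sin (x + 14 * PI) = sin x)
  by (intros x; replace (x + 14 * PI) with (x + 2 * INR 7 * PI) by (simpl; ring); apply sin_period).
unfold motion; rewrite E, (global_f_period _ _ _ _ _ _ _ _ G), (global_r_period _ _ _ _ _ _ _ _ G),
  (global_th_period _ _ _ _ _ _ _ _ G), Hc, Hs; reflexivity.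
Qed.

(** The decimals are the central values; the tolerances cover the spread of the parameters over the
    box. *)
Lemma parameter_bounds z : in_box z ->
  Rabs (par_q z - 71469552 / 10000000) <= 5 / 1000000 /\
  Rabs (par_m z - 115411041 / 100000000) <= 5 / 10000000 /\
  Rabs (par_c z - 39842960 / 100000000) <= 25 / 10000000.
Proof.
intros (_ & _ & B1 & B2 & B3).
assert (U : forall u b, Rabs u * IZR Sv <= b -> - b / IZR Sv <= u <= b / IZR Sv).
  intros u b H; assert (HS := Sv_pos).
  assert (Q : Rabs u <= b / IZR Sv).
    apply Rmult_le_reg_r with (IZR Sv); [exact HS|].
    replace (b / IZR Sv * IZR Sv) with b by (field; lra); exact H.
  apply Rabs_le_between in Q; replace (- b / IZR Sv) with (- (b / IZR Sv)) by (field; lra); exact Q.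
apply U in B1; apply U in B2; apply U in B3.
unfold par_q, par_m, par_c.
change (-1) with (IZR (-1)); rewrite curve_end; unfold curve; simpl; unfold Sv, Sp in *.
unfold q0, m0, bq1, bq2, bq3, bm1, bm2, bm3.
repeat split; apply Rabs_le; lra.
Qed.

Lemma sqrt_bounds q : Rabs (q - 71469552 / 10000000) <= 5 / 1000000 ->
  2673378 / 1000000 <= sqrt q <= 2673380 / 1000000.
Proof.
intros H; apply Rabs_le_between in H.
rewrite <- (sqrt_pow2 (2673378 / 1000000)), <- (sqrt_pow2 (2673380 / 1000000)) by lra.
split; apply sqrt_le_1_alt; lra.
Qed.

Theorem theorem6p1 :
  exists abar bbar tbar : R,
    Rabs (abar - a0) < sa + da /\
    Rabs (bbar - b0) < sb /\
    Rabs (tbar - t0) < 6 * (st + dt) /\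
    exists F Rad Theta : R -> R,
      is_maximal_solution abar bbar m_infty p_infty F Rad Theta /\
      three_body_solution masses (motion F Rad Theta) /\
      periodic_motion (36 * tbar) (motion F Rad Theta) /\
      Theta tbar = 7 * PI / 18.
Proof.
destruct exists_quarter as (z & f & df & r & dr & th & Hz & Q).
destruct (quarter_extends _ _ _ _ _ _ _ _ Q) as (F & dF & Rr & dR & Th & G).
destruct (parameter_bounds z Hz) as (Bq & Bm & Bc).
set (q := par_q z) in *; set (m := par_m z) in *; set (c := par_c z) in *.
assert (BT := sqrt_bounds q Bq); set (T := sqrt q) in *.
apply Rabs_le_between in Bq; apply Rabs_le_between in Bm; apply Rabs_le_between in Bc.
assert (HT : 0 < T) by lra.
assert (Hq : 0 < q) by lra.
assert (M := global_rescaled _ _ _ _ _ _ _ _ Hq G); cbv zeta in M; fold T in M.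
(* Multiplying by [T] makes the bounds on the quotients [10 * m / T] and [10 * c / T] linear in the
   enclosed quantities. *)
assert (near : forall x y e, (y - e) * T < x < (y + e) * T -> Rabs (x / T - y) < e).
  intros x y e Hx.
  assert (E : x = x / T * T) by (field; lra).
  apply Rabs_def1; apply Rmult_lt_reg_r with T; lra.
exists (10 * m / T), (10 * c / T), T.
split; [apply near; unfold a0, sa, da; lra|].
split; [apply near; unfold b0, sb; lra|].
split; [apply Rabs_def1; unfold t0, st, dt; lra|].
exists (fun t => 10 * F (/ T * t)), (fun t => 10 * Rr (/ T * t)), (fun t => Th (/ T * t)).
split; [|split; [|split]].
- apply (motion_on_maximal _ _ _ _ _ _ _ M); rewrite Rmult_0_r.
  + rewrite (global_f0 _ _ _ _ _ _ _ _ G); ring.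
  + rewrite (global_df0 _ _ _ _ _ _ _ _ G); field; lra.
  + rewrite (global_r0 _ _ _ _ _ _ _ _ G); ring.
  + rewrite (global_dr0 _ _ _ _ _ _ _ _ G); ring.
  + exact (global_th0 _ _ _ _ _ _ _ _ G).
- exact (motion_three_body _ _ _ _ _ _ M).
- exact (global_periodic _ _ _ _ _ _ _ _ Hq G).
- replace (/ T * T) with 1 by (field; lra).
  exact (global_th1 _ _ _ _ _ _ _ _ G).
Qed.
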